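(* Let $n\ge2$ and $a\in\{0,\dots,n-1\}$. In the sector $\mathcal{H}_a$, the allowed angular-momentum quantum numbers are $$m=a+n\ell,\qquad \ell\in\mathbb{Z},$$ and therefore the self-adjoint operator $\hat L_z=-i\hbar\,\partial_\phi$ on $\mathcal{H}_a$ has spectrum $$\mathrm{Spec}(\hat L_z|_{\mathcal{H}_a})=\hbar(a+n\mathbb{Z}).$$ Each eigenvalue has infinite (radial) multiplicity, and the allowed angular quantum numbers agree exactly with those given by the boundary-condition requirement $e^{2\pi i m/n}=e^{2\pi i a/n}$ and with those given by the orbifold Bohr--Sommerfeld condition $p_\phi=\hbar m$ with $\frac{p_\phi}{n\hbar}-\frac{a}{n}\in\mathbb{Z}$.
   Context: $\mathcal{H}_a=\{\psi\in L^2(\mathbb{C})\mid \psi(e^{2\pi i/n}z)=e^{2\pi i a/n}\psi(z)\text{ a.e.}\}$ with inner product $\frac1n\int_{\mathbb{C}}\overline{\psi}\varphi\,d^2z$; equivalently (by restriction) $L^2(W;r\,dr\,d\phi)$ with the wedge $W=(0,\infty)\times(0,2\pi/n)$ in polar coordinates $(r,\phi)$. The operator $\hat L_z=-i\hbar\partial_\phi$ has domain, in the wedge realization, $\{\psi\in L^2(W;r\,dr\,d\phi)\mid \partial_\phi\psi\in L^2(W;r\,dr\,d\phi),\ \psi(r,2\pi/n)=e^{2\pi i a/n}\psi(r,0)\text{ in trace sense}\}$; equivalently it is the generator of the unitary rotation group on $L^2(\mathbb{C})$ restricted to $\mathcal{H}_a$. An allowed angular quantum number is an $m$ for which $f(r)e^{im\phi}$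 belongs to the sector. Bohr--Sommerfeld comparison: on $T^*\mathbb{C}$ with $r>0$ and canonical polar coordinates $(r,\phi,p_r,p_\phi)$, the prequantum line bundle in sector $a$ is the trivial bundle with connection $d-\frac{i}{\hbar}(p_r\,dr+p_\phi\,d\phi)$ on which the generator $g$ of $\mathbb{Z}_n$ acts on fibers by $e^{2\pi i a/n}$; the condition is triviality of the orbifold holonomy $\exp\left(\frac{i}{\hbar}\int_0^{2\pi/n}p_\phi\,d\phi\right)e^{-2\pi i a/n}$ of the loop given by an angular sweep of $2\pi/n$ closed by $g$, at fixed $(p_r,p_\phi)$. $\hbar>0$ is fixed. *)

(* Defs.v *)
From HB Require Import structures.
From mathcomp Require Import all_boot all_order all_algebra complex.
From mathcomp Require Import all_classical all_reals all_analysis.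

Set Implicit Arguments.
Unset Strict Implicit.
Unset Printing Implicit Defensive.

Import Order.TTheory GRing.Theory Num.Theory.
Import numFieldNormedType.Exports.

Local Open Scope classical_set_scope.
Local Open Scope ring_scope.

Definition expi (R : realType) (t : R) : R[i] := Complex (cos t) (sin t).

(* The point (x, y) stands for the complex number z = x + i y, so that [rot t]
   is multiplication by e^{it}. *)
Definition rot (R : realType) (t : R) (z : R * R) : R * R :=
  (z.1 * cos t - z.2 * sin t, z.1 * sin t + z.2 * cos t).

Definition plane (R : realType) := (measurableTypeR R * measurableTypeR R)%type.

(* Elements of L^2(C) are represented by functions; equality of elements is
   [eq_ae] and every notion below is insensitive to the representative. *)
Definition wavefun (R : realType) := plane R -> R[i].

Definition plane_measure (R : realType) : set (plane R) -> \bar R :=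
  (@lebesgue_measure R \x @lebesgue_measure R)%E.
Arguments plane_measure : clear implicits.

Definition eq_ae (R : realType) (psi chi : wavefun R) : Prop :=
  {ae plane_measure R, forall z, psi z = chi z}.

Definition sqnorm (R : realType) (w : R[i]) : R :=
  complex.Re w ^+ 2 + complex.Im w ^+ 2.

Definition square_integrable (R : realType) (psi : wavefun R) : Prop :=
  [/\ measurable_fun (T := plane R) setT (fun z => complex.Re (psi z)),
      measurable_fun (T := plane R) setT (fun z => complex.Im (psi z)) &
      (\int[plane_measure R]_z (sqnorm (psi z))%:E < +oo)%E].

Definition sector (R : realType) (n a : nat) (psi : wavefun R) : Prop :=
  square_integrable psi /\
  {ae plane_measure R, forall z,
     psi (rot (2 * pi / n%:R) z) = expi (2 * pi * a%:R / n%:R) * psi z}.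

Definition cintegral (R : realType) (f : wavefun R) : R[i] :=
  Complex (\int[plane_measure R]_z complex.Re (f z))
          (\int[plane_measure R]_z complex.Im (f z)).

Definition inner (R : realType) (n : nat) (psi phi : wavefun R) : R[i] :=
  (n%:R^-1)%:C%C * cintegral (fun z => (psi z)^*%C * phi z).

(* The square root of [inner n psi psi]. *)
Definition hnorm (R : realType) (n : nat) (psi : wavefun R) : R :=
  Num.sqrt (n%:R^-1 * \int[plane_measure R]_z sqnorm (psi z)).

(* An operator in H_a, possibly unbounded, is given by its graph:
   [T psi chi] says that psi is in the domain and that T psi = chi. *)
Definition operator (R : realType) := wavefun R -> wavefun R -> Prop.

(* The generator d/dt at t = 0 of the unitary group
   (U(t) psi)(z) = psi (e^{it} z) on H_a; the derivative is the limit of the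
   difference quotients in the norm of H_a. *)
Definition rotation_generator (R : realType) (n a : nat) : operator R :=
  fun psi delta =>
    [/\ sector n a psi, sector n a delta &
        hnorm n (fun z => (t^-1)%:C%C * (psi (rot t z) - psi z) - delta z)
          @[t --> (0 : R)^'] --> (0 : R)].

(* L_z = - i hbar d/dphi *)
Definition Lz (R : realType) (hbar : R) (n a : nat) : operator R :=
  fun psi chi => exists2 delta, rotation_generator n a psi delta &
    chi = (fun z => - (Complex 0 hbar) * delta z).

Definition densely_defined (R : realType) (n a : nat) (T : operator R) : Prop :=
  forall psi, sector n a psi -> forall e : R, 0 < e ->
    exists phi eta, T phi eta /\ hnorm n (fun z => psi z - phi z) < e.

Definition adjoint (R : realType) (n a : nat) (T : operator R) : operator R :=
  fun psi chi =>
    [/\ sector n a psi, sector n a chi &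
        forall phi eta, T phi eta -> inner n psi eta = inner n chi phi].

Definition self_adjoint (R : realType) (n a : nat) (T : operator R) : Prop :=
  densely_defined n a T /\
  forall psi chi, T psi chi <-> adjoint n a T psi chi.

(* T - lam maps its domain bijectively onto H_a and has a bounded inverse. *)
Definition resolvent_set (R : realType) (n a : nat) (T : operator R) :
    set R[i] :=
  [set lam |
    [/\ forall psi chi, T psi chi ->
          eq_ae (fun z => chi z - lam * psi z) (fun=> 0) ->
          eq_ae psi (fun=> 0),
        forall eta, sector n a eta ->
          exists psi chi, T psi chi /\
            eq_ae (fun z => chi z - lam * psi z) eta &
        exists C : R, forall psi chi, T psi chi ->
          hnorm n psi <= C * hnorm n (fun z => chi z - lam * psi z)]].

Definition spectrum (R : realType) (n a : nat) (T : operator R) : set R[i] :=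
  ~` resolvent_set n a T.

Definition point_spectrum (R : realType) (T : operator R) : set R[i] :=
  [set lam | exists psi, ~ eq_ae psi (fun=> 0) /\
                         T psi (fun z => lam * psi z)].

(* psi(z) = f(r) e^{im phi} in polar coordinates with 0 <= phi < 2 pi. The
   number m is an arbitrary real: that it has to be an integer is part of what
   membership in a sector imposes. The value at the origin is left free. *)
Definition angular_mode (R : realType) (m : R) (f : R -> R[i])
    (psi : wavefun R) : Prop :=
  forall r phi : R, 0 < r -> 0 <= phi < 2 * pi ->
    psi (r * cos phi, r * sin phi) = f r * expi (m * phi).

Definition allowed (R : realType) (n a : nat) : set R :=
  [set m | exists f psi, [/\ angular_mode m f psi, sector n a psi &
                             ~ eq_ae psi (fun=> 0)]].

Definition lin_indep (R : realType) (N : nat) (e : 'I_N -> wavefun R) : Prop :=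
  forall c : 'I_N -> R[i],
    eq_ae (fun z => \sum_(k < N) c k * e k z) (fun=> 0) -> forall k, c k = 0.

(* For every N there are N linearly independent eigenvectors of the form
   f(r) e^{im phi} for the eigenvalue lam. *)
Definition infinite_radial_multiplicity (R : realType) (T : operator R)
    (lam : R[i]) (m : R) : Prop :=
  forall N : nat, exists (f : 'I_N -> R -> R[i]) (e : 'I_N -> wavefun R),
    [/\ forall k, angular_mode m (f k) (e k),
        forall k, T (e k) (fun z => lam * e k z) &
        lin_indep e].

(* Holonomy of the connection d - (i/hbar)(p_r dr + p_phi dphi) along the
   angular sweep 0 <= phi <= 2 pi / n at fixed (p_r, p_phi), closed by the
   generator of Z_n; r is constant on the sweep, so p_r dr does not
   contribute. *)
Definition orbifold_holonomy (R : realType) (hbar : R) (n a : nat) (pphi : R) :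
    R[i] :=
  expi (hbar^-1 *
        \int[@lebesgue_measure R]_(phi in `[0, (2 * pi / n%:R)%R]) pphi) *
  expi (- (2 * pi * a%:R / n%:R)).

Definition bohr_sommerfeld (R : realType) (hbar : R) (n a : nat) : set R :=
  [set pphi | orbifold_holonomy hbar n a pphi = 1].

(* Main.v *)
(* The idea. Rotations preserve the planar Lebesgue measure, so they act by a
   strongly continuous unitary group U with U(2 pi / n) = e^{2 pi i a / n} on
   the sector. For complex k the vector K = int_0^s e^{k t} U(t) g dt satisfies
   (A + k) K = e^{k s} U(s) g - g, where A is the generator. At s = 2 pi / n
   the right-hand side is (e^{2 pi k / n} e^{2 pi i a / n} - 1) g, which gives a
   bounded solution operator for L_z - lam, unless lam is in hbar (a + n Z). As
   L_z is symmetric, solvability at lam = i and lam = - i makes it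
   self-adjoint, and solvability at the conjugate of lam bounds the inverse of
   L_z - lam. At lam = hbar m with m in a + n Z, multiples of z^m (of
   powers of the conjugate of z if m < 0) cut off to disjoint annuli are
   independent eigenvectors. *)
From HB Require Import structures.
From mathcomp Require Import all_boot all_order all_algebra complex.
From mathcomp Require Import all_classical all_reals all_analysis.
From mathcomp Require Import measurable_realfun ring lra.
Require Import Defs.

Set Implicit Arguments.
Unset Strict Implicit.
Unset Printing Implicit Defensive.

Import Order.TTheory GRing.Theory Num.Theory.
Import numFieldNormedType.Exports.
Import HBNNSimple.

Local Open Scope classical_set_scope.
Local Open Scope ring_scope.

Local Notation mu1 := (@lebesgue_measure _).

(** * Invariance of the planar measure under rotations *)

(** The formula for $K$ comes from shifting the interval: $e^{kt}U(t)K$ is the orbit integral over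
    $[t,s+t]$, so its derivative at $t=0$ is the difference of the endpoint values. With
    $k=\lambda/(i\hbar)$ one has $L_z-\lambda=-i\hbar(A+k)$. Vectors are functions up to null sets,
    so the integral of an orbit is taken pointwise in $z$. Its norm is controlled by Cauchy-Schwarz
    in time followed by Tonelli, and relations between orbit integrals hold only almost everywhere.
    Estimates use squared norms and $|u+v|^2\le 2|u|^2+2|v|^2$; this is the source of the
    denominators 4, 8, 12 and 16 in the epsilon arguments. Strong continuity is built up from
    half-planes: the sets whose indicator, cut to a disc, moves continuously under rotation form a
    $\sigma$-algebra, and simple functions do the rest. In [allowed], $m$ is an arbitrary real and
    the polar form is prescribed only for angles in $[0,2\pi)$, so phases may be compared only along
    rotations that do not cross the cut. The hypothesis $n\ge2$ guarantees such a rotation from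
    every angle. *)

Lemma plane_measure_sigma_finite (R : realType) :
  sigma_finite [set: plane R] (plane_measure R).
Proof.
exists (fun k => `[(- k%:R), k%:R] `*` `[(- k%:R), k%:R]) => [|k].
  apply/seteqP; split => // -[x y] _.
  have [k xyk] : exists k : nat, Num.max `|x| `|y| <= k%:R.
    exists (Num.bound (Num.max `|x| `|y|)).
    by apply/ltW/archi_boundP; rewrite le_max normr_ge0.
  move: xyk; rewrite ge_max !ler_norml => /andP[xk yk].
  by exists k => //; split => /=; rewrite in_itv.
split; first by apply: measurableX.
rewrite /plane_measure product_measure1E//.
have h : (mu1 `[(- k%:R)%R, k%:R%R]%classic < +oo :> \bar R)%E.
  by rewrite lebesgue_measure_itv/=; case: ifP => // _; rewrite -EFinB ltry.
by apply: lte_mul_pinfty => //; rewrite ge0_fin_numE.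
Qed.

(** With these structures Tonelli can exchange an integral over time with one over the plane. *)
HB.instance Definition _ (R : realType) := Measure.on (plane_measure R).
HB.instance Definition _ (R : realType) :=
  Measure_isSigmaFinite.Build _ _ _ (plane_measure R)
    (@plane_measure_sigma_finite R).


(** The pushforward under the translation agrees with Lebesgue measure on half-open intervals, which
    determine it. *)
Lemma lebesgue_measureD (R : realType) (c : R) (A : set (measurableTypeR R)) :
  measurable A ->
  mu1 ((fun x : measurableTypeR R => x + c) @^-1` A) = mu1 A.
Proof.
move=> mA.
have mD : measurable_fun [set: measurableTypeR R]
    (fun x : measurableTypeR R => (x + c : measurableTypeR R)).
  exact: measurable_funD.
pose mphi_mixin := isMeasurableFun.Build _ _ _ _ _ mD.
pose f : {mfun _ >-> _} :=
  HB.pack (fun x : measurableTypeR R => (x + c : measurableTypeR R)) mphi_mixin.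
apply/esym/(@lebesgue_measure_unique R (pushforward mu1 f)) => // _ [[a b]] _ <-.
rewrite /= /pushforward.
have -> : f @^-1` `]a, b] = `]a - c, b - c]%classic.
  by apply/seteqP; split => x /=; rewrite !in_itv /= ltrBlDr lerBrDr.
rewrite !lebesgue_measure_itv/=.
by rewrite !lte_fin ltrBlDr subrK -!EFinB opprB addrA subrK.
Qed.

Definition measure_preserving d (T : measurableType d) (R : realType)
    (mu : {measure set T -> \bar R}) (f : T -> T) : Prop :=
  measurable_fun setT f /\
  forall A, measurable A -> mu (f @^-1` A) = mu A.

Lemma measure_preserving_comp d (T : measurableType d) (R : realType)
    (mu : {measure set T -> \bar R}) (f g : T -> T) :
  measure_preserving mu f -> measure_preserving mu g ->
  measure_preserving mu (f \o g).
Proof.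
move=> [mf ef] [mg eg]; split; first exact: measurableT_comp.
move=> A mA; rewrite comp_preimage eg ?ef//.
by rewrite -[X in measurable X]setTI; exact: mf.
Qed.

(** Each vertical section is translated by a constant, so the claim reduces to translation
    invariance on the line. *)
Lemma shear_y_preserving (R : realType) (c : R) :
  measure_preserving (plane_measure R) (fun z => (z.1, z.2 + c * z.1)).
Proof.
have mf : measurable_fun [set: plane R]
    (fun z : plane R => (z.1, z.2 + c * z.1) : plane R).
  apply/measurable_fun_pairP; split => /=; first exact: measurable_fst.
  apply: measurable_funD; first exact: measurable_snd.
  by apply: measurable_funM => //; exact: measurable_fst.
split => // A mA; rewrite /plane_measure /product_measure1 /=.
apply: eq_integral => x _ /=.
rewrite -(@lebesgue_measureD R (c * x) (xsection A x)); last first.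
  exact: measurable_xsection.
by congr (mu1 _); apply/seteqP; split => y /=; rewrite /xsection /= !inE.
Qed.

(** Now the horizontal sections are translated, so the product measure is first rewritten with the
    order of integration exchanged. *)
Lemma shear_x_preserving (R : realType) (c : R) :
  measure_preserving (plane_measure R) (fun z => (z.1 + c * z.2, z.2)).
Proof.
have mf : measurable_fun [set: plane R]
    (fun z : plane R => (z.1 + c * z.2, z.2) : plane R).
  apply/measurable_fun_pairP; split => /=; last exact: measurable_snd.
  apply: measurable_funD; first exact: measurable_fst.
  by apply: measurable_funM => //; exact: measurable_snd.
have E (A : set (plane R)) : measurable A ->
    plane_measure R A = (@lebesgue_measure R \x^ @lebesgue_measure R)%E A.
  move=> mA; apply: product_measure_unique => // B C mB mC.
  by rewrite /= product_measure2E.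
split => // A mA.
rewrite [LHS]E ?[RHS]E//; last by rewrite -[X in measurable X]setTI; exact: mf.
rewrite /product_measure2 /=; apply: eq_integral => y _ /=.
rewrite -(@lebesgue_measureD R (c * y) (ysection A y)); last first.
  exact: measurable_ysection.
by congr (mu1 _); apply/seteqP; split => x /=; rewrite /ysection /= !inE.
Qed.

Lemma rotD (R : realType) (s t : R) z : rot (s + t) z = rot s (rot t z).
Proof. by rewrite /rot cosD sinD /=; congr pair; ring. Qed.

Lemma rot0 (R : realType) (z : R * R) : rot 0 z = z.
Proof. by case: z => x y; rewrite /rot cos0 sin0 /=; congr pair; ring. Qed.

Lemma rotK (R : realType) (t : R) : cancel (rot t) (rot (- t)).
Proof. by move=> z; rewrite -rotD addNr rot0. Qed.

Lemma rot_preserving_cos (R : realType) (t : R) : cos t != -1 ->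
  measure_preserving (plane_measure R) (rot t).
Proof.
(* [s] is $\tan(t/2)$; $R_t$ is a horizontal shear by $-s$, a vertical one by $\sin t$, and again a
   horizontal one by $-s$. *)
move=> ct; pose s := sin t / (1 + cos t).
have ct1 : 1 + cos t != 0 by rewrite addrC -[1]opprK subr_eq0.
have E : rot t = (fun z => (z.1 + (- s) * z.2, z.2)) \o
    ((fun z => (z.1, z.2 + sin t * z.1)) \o (fun z => (z.1 + (- s) * z.2, z.2))).
  apply/funext => -[x y]; rewrite /rot /=.
  have st : sin t * s = 1 - cos t.
    rewrite /s mulrA -expr2 sin2cos2; field => //.
  have sc : s * (1 + cos t) = sin t by rewrite /s mulfVK.
  have e : y + sin t * (x + - s * y) = x * sin t + y * cos t.
    transitivity (y + sin t * x - (sin t * s) * y); first by ring.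
    by rewrite st; ring.
  rewrite e; congr pair.
  transitivity (x * (1 - sin t * s) - y * (s * (1 + cos t))); last by ring.
  by rewrite st sc; ring.
rewrite E; apply: measure_preserving_comp; first exact: shear_x_preserving.
apply: measure_preserving_comp; first exact: shear_y_preserving.
exact: shear_x_preserving.
Qed.

(* A rotation is a product of three shears, except for the half turn, which is
   a product of two quarter turns. *)
Lemma rot_preserving (R : realType) (t : R) :
  measure_preserving (plane_measure R) (rot t).
Proof.
have [ct|] := eqVneq (cos t) (-1); last exact: rot_preserving_cos.
have c2 : cos (t / 2) = 0.
  move: ct; rewrite [t in cos t](_ : t = t / 2 *+ 2); last by rewrite mulr2n; lra.
  rewrite cos_mulr2n => /eqP; rewrite subr_eq addNr mulrn_eq0 sqrf_eq0.
  by move=> /eqP.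
have -> : rot t = rot (t / 2) \o rot (t / 2).
  by apply/funext => z /=; rewrite -rotD; congr rot; lra.
by apply: measure_preserving_comp; apply: rot_preserving_cos; rewrite c2; lra.
Qed.

(** * Square-integrable complex functions *)

Lemma ReM (R : realType) (x y : R[i]) :
  complex.Re (x * y) =
  complex.Re x * complex.Re y - complex.Im x * complex.Im y.
Proof. by case: x y => a b [c e]. Qed.

Lemma ImM (R : realType) (x y : R[i]) :
  complex.Im (x * y) =
  complex.Re x * complex.Im y + complex.Im x * complex.Re y.
Proof. by case: x y => a b [c e]. Qed.

Lemma ReD (R : realType) (x y : R[i]) :
  complex.Re (x + y) = complex.Re x + complex.Re y.
Proof. by case: x y => a b [c e]. Qed.

Lemma ImD (R : realType) (x y : R[i]) :
  complex.Im (x + y) = complex.Im x + complex.Im y.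
Proof. by case: x y => a b [c e]. Qed.

Lemma ReN (R : realType) (x : R[i]) : complex.Re (- x) = - complex.Re x.
Proof. by case: x. Qed.

Lemma ImN (R : realType) (x : R[i]) : complex.Im (- x) = - complex.Im x.
Proof. by case: x. Qed.

Lemma ReC (R : realType) (x : R[i]) : complex.Re x^*%C = complex.Re x.
Proof. by case: x. Qed.

Lemma ImC (R : realType) (x : R[i]) : complex.Im x^*%C = - complex.Im x.
Proof. by case: x. Qed.

Definition ReImE := (ReM, ImM, ReD, ImD, ReN, ImN, ReC, ImC).

Lemma complexP (R : realType) (x y : R[i]) :
  complex.Re x = complex.Re y -> complex.Im x = complex.Im y -> x = y.
Proof. by case: x y => a b [c e] /= -> ->. Qed.

Section sqnorm_theory.
Variable R : realType.
Implicit Types x y : R[i].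

Lemma sqnorm_ge0 x : 0 <= sqnorm x.
Proof. by rewrite addr_ge0// sqr_ge0. Qed.

Lemma sqnormM x y : sqnorm (x * y) = sqnorm x * sqnorm y.
Proof. by rewrite /sqnorm !ReImE; ring. Qed.

Lemma sqnormN x : sqnorm (- x) = sqnorm x.
Proof. by rewrite /sqnorm !ReImE; ring. Qed.

Lemma sqnormC x : sqnorm x^*%C = sqnorm x.
Proof. by rewrite /sqnorm !ReImE; ring. Qed.

Lemma sqnormD x y : sqnorm (x + y) <= 2 * sqnorm x + 2 * sqnorm y.
Proof.
have := sqnorm_ge0 (x - y); rewrite /sqnorm !ReImE => h.
by rewrite -subr_ge0; apply: le_trans h _; rewrite le_eqVlt; apply/orP; left;
  apply/eqP; ring.
Qed.

Lemma sqnorm_eq0 x : (sqnorm x == 0) = (x == 0).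
Proof.
case: x => a b; rewrite /sqnorm /= paddr_eq0 ?sqr_ge0// !sqrf_eq0.
by rewrite eq_complex.
Qed.

Lemma sqnorm0 : sqnorm (0 : R[i]) = 0.
Proof. by apply/eqP; rewrite sqnorm_eq0. Qed.

Lemma sqnorm1 : sqnorm (1 : R[i]) = 1.
Proof. by rewrite /sqnorm /= expr0n/= addr0 expr1n. Qed.

Lemma sqnorm_real (r : R) : sqnorm r%:C%C = r ^+ 2.
Proof. by rewrite /sqnorm /= expr0n/= addr0. Qed.

Lemma sqnorm_expi (t : R) : sqnorm (expi t) = 1.
Proof. by rewrite /sqnorm /= cos2Dsin2. Qed.

End sqnorm_theory.

(** * Measurable complex-valued functions *)

Definition cmeasurable d (T : measurableType d) (R : realType) (f : T -> R[i]) :=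
  measurable_fun setT (fun x => complex.Re (f x)) /\
  measurable_fun setT (fun x => complex.Im (f x)).

Lemma cmeasurableD d (T : measurableType d) (R : realType) (f g : T -> R[i]) :
  cmeasurable f -> cmeasurable g -> cmeasurable (fun x => f x + g x).
Proof.
move=> [fr fi] [gr gi]; split.
  by under eq_fun do rewrite ReD; exact: measurable_funD.
by under eq_fun do rewrite ImD; exact: measurable_funD.
Qed.

Lemma cmeasurableM d (T : measurableType d) (R : realType) (f g : T -> R[i]) :
  cmeasurable f -> cmeasurable g -> cmeasurable (fun x => f x * g x).
Proof.
move=> [fr fi] [gr gi]; split.
  under eq_fun do rewrite ReM.
  by apply: measurable_funB; exact: measurable_funM.
under eq_fun do rewrite ImM.
by apply: measurable_funD; exact: measurable_funM.
Qed.

Lemma cmeasurable_cst d (T : measurableType d) (R : realType) (c : R[i]) :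
  @cmeasurable d T R (fun=> c).
Proof. by split; exact: measurable_cst. Qed.

Lemma cmeasurableZ d (T : measurableType d) (R : realType) (c : R[i]) (f : T -> R[i]) :
  cmeasurable f -> cmeasurable (fun x => c * f x).
Proof. by apply: cmeasurableM; exact: cmeasurable_cst. Qed.

Lemma cmeasurableN d (T : measurableType d) (R : realType) (f : T -> R[i]) :
  cmeasurable f -> cmeasurable (fun x => - f x).
Proof.
by move=> mf; under [X in cmeasurable X]eq_fun do rewrite -mulN1r; exact: cmeasurableZ.
Qed.

Lemma cmeasurableC d (T : measurableType d) (R : realType) (f : T -> R[i]) :
  cmeasurable f -> cmeasurable (fun x => (f x)^*%C).
Proof.
move=> [fr fi]; split.
  by under eq_fun do rewrite ReC.
by under eq_fun do rewrite ImC; exact: measurable_funN.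
Qed.

Lemma cmeasurable_comp d1 d2 (T1 : measurableType d1) (T2 : measurableType d2)
    (R : realType) (f : T2 -> R[i]) (g : T1 -> T2) :
  cmeasurable f -> measurable_fun setT g -> cmeasurable (fun x => f (g x)).
Proof.
move=> [fr fi] mg; split; first exact: (measurableT_comp fr mg).
exact: (measurableT_comp fi mg).
Qed.

Lemma cmeasurable_sqnorm d (T : measurableType d) (R : realType) (f : T -> R[i]) :
  cmeasurable f -> measurable_fun setT (fun x => sqnorm (f x)).
Proof.
by move=> [fr fi]; apply: measurable_funD; exact: measurable_funX.
Qed.

(* AM-GM; it replaces the Cauchy-Schwarz inequality in what follows. *)
Lemma norm_dot2_le (R : realType) (c a b p q : R) : 0 < c ->
  `|a * p + b * q| <= c * (a ^+ 2 + b ^+ 2) + c^-1 * (p ^+ 2 + q ^+ 2).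
Proof.
(* Rescaling the second vector by $c^{-1}$ puts the same factor [c] on every term and reduces the
   claim to weight 1. *)
move=> c0; pose v := c^-1 * p; pose w := c^-1 * q.
have pv : p = c * v by rewrite /v mulVKf// gt_eqF.
have qw : q = c * w by rewrite /w mulVKf// gt_eqF.
have -> : c^-1 * (p ^+ 2 + q ^+ 2) = c * (v ^+ 2 + w ^+ 2).
  by rewrite pv qw; field; rewrite gt_eqF.
rewrite pv qw -mulrDr.
have -> : a * (c * v) + b * (c * w) = c * (a * v + b * w) by ring.
rewrite normrM gtr0_norm// ler_pM2l// ler_norml.
by have := sqr_ge0 (a + v); have := sqr_ge0 (a - v);
  have := sqr_ge0 (b + w); have := sqr_ge0 (b - w);
  have := sqr_ge0 a; have := sqr_ge0 b; have := sqr_ge0 v; have := sqr_ge0 w;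
  rewrite !sqrrD !sqrrN; nra.
Qed.

(** * Integrals of complex-valued functions *)

Definition cintegrable d (T : measurableType d) (R : realType)
    (mu : {measure set T -> \bar R}) (D : set T) (f : T -> R[i]) :=
  mu.-integrable D (EFin \o (fun x => complex.Re (f x))) /\
  mu.-integrable D (EFin \o (fun x => complex.Im (f x))).

Definition cint d (T : measurableType d) (R : realType)
    (mu : {measure set T -> \bar R}) (D : set T) (f : T -> R[i]) : R[i] :=
  Complex (\int[mu]_(x in D) complex.Re (f x))
          (\int[mu]_(x in D) complex.Im (f x)).

Section cint_theory.
Context d (T : measurableType d) (R : realType).
Variables (mu : {measure set T -> \bar R}) (D : set T).
Hypothesis mD : measurable D.
Implicit Types f g : T -> R[i].

Lemma cintegrableZ c f : cintegrable mu D f -> cintegrable mu D (fun x => c * f x).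
Proof.
move=> [fr fi]; split.
  apply: (eq_integrable mD _ _ _ (integrableB mD
    (integrableZl mD (complex.Re c) fr) (integrableZl mD (complex.Im c) fi))).
  by move=> x _ /=; rewrite ReM.
apply: (eq_integrable mD _ _ _ (integrableD mD
  (integrableZl mD (complex.Re c) fi) (integrableZl mD (complex.Im c) fr))).
by move=> x _ /=; rewrite ImM.
Qed.

Lemma cintegrableN f : cintegrable mu D f -> cintegrable mu D (fun x => - f x).
Proof.
move=> [fr fi]; split.
  apply: (eq_integrable mD _ _ _ (integrableZl mD (-1) fr)) => x _ /=.
  by rewrite ReN EFinN mulN1e.
apply: (eq_integrable mD _ _ _ (integrableZl mD (-1) fi)) => x _ /=.
by rewrite ImN EFinN mulN1e.
Qed.

Lemma cintD f g : cintegrable mu D f -> cintegrable mu D g ->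
  cint mu D (fun x => f x + g x) = cint mu D f + cint mu D g.
Proof.
move=> [fr fi] [gr gi]; apply: complexP; rewrite !ReImE /= -RintegralD//.
  by apply: eq_Rintegral => x _; rewrite ReD.
by apply: eq_Rintegral => x _; rewrite ImD.
Qed.

Lemma cintZ c f : cintegrable mu D f ->
  cint mu D (fun x => c * f x) = c * cint mu D f.
Proof.
move=> [fr fi]; apply: complexP; rewrite !ReImE /= -!RintegralZl//.
  rewrite -RintegralB//; first by apply: eq_Rintegral => x _; rewrite ReM.
    exact: (integrableZl mD _ fr).
  exact: (integrableZl mD _ fi).
rewrite -RintegralD//; first by apply: eq_Rintegral => x _; rewrite ImM.
  exact: (integrableZl mD _ fi).
exact: (integrableZl mD _ fr).
Qed.

Lemma cintN f : cintegrable mu D f -> cint mu D (fun x => - f x) = - cint mu D f.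
Proof.
move=> fI; rewrite -mulN1r -cintZ//.
by congr cint; apply/funext => x; rewrite mulN1r.
Qed.

Lemma eq_cint f g : (forall x, D x -> f x = g x) -> cint mu D f = cint mu D g.
Proof.
by move=> fg; congr Complex; apply: eq_Rintegral => x /set_mem Dx; rewrite fg.
Qed.

Lemma eq_cintegrable f g : (forall x, D x -> f x = g x) ->
  cintegrable mu D f -> cintegrable mu D g.
Proof.
move=> fg [fr fi]; split.
  by apply: (eq_integrable mD _ _ _ fr) => x /set_mem Dx /=; rewrite fg.
by apply: (eq_integrable mD _ _ _ fi) => x /set_mem Dx /=; rewrite fg.
Qed.

End cint_theory.

(** * Squared norms of wave functions *)

Definition enorm2 (R : realType) (psi : wavefun R) : \bar R :=
  (\int[plane_measure R]_z (sqnorm (psi z))%:E)%E.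

(** An infinite integral gives the default value 0 here, so finiteness is always settled through
    [enorm2] first. *)
Definition norm2 (R : realType) (psi : wavefun R) : R :=
  \int[plane_measure R]_z sqnorm (psi z).

Lemma sqiP (R : realType) (psi : wavefun R) :
  square_integrable psi <-> cmeasurable (psi : plane R -> R[i]) /\ (enorm2 psi < +oo)%E.
Proof. by split=> [[? ? ?]|[[? ?] ?]]. Qed.

Lemma enorm2_ge0 (R : realType) (psi : wavefun R) : (0 <= enorm2 psi)%E.
Proof. by apply: integral_ge0 => z _; rewrite lee_fin sqnorm_ge0. Qed.

Lemma norm2_ge0 (R : realType) (psi : wavefun R) : 0 <= norm2 psi.
Proof. exact/fine_ge0/enorm2_ge0. Qed.

Lemma norm2_cst0 (R : realType) : norm2 (fun=> 0 : R[i]) = 0.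
Proof.
rewrite /norm2; under eq_Rintegral do rewrite sqnorm0.
by rewrite /Rintegral integral0.
Qed.

Lemma norm2E (R : realType) (psi : wavefun R) : square_integrable psi ->
  (norm2 psi)%:E = enorm2 psi.
Proof.
by move=> /sqiP[_ h]; rewrite /norm2 /Rintegral fineK// ge0_fin_numE// enorm2_ge0.
Qed.

Lemma hnormE (R : realType) n (psi : wavefun R) :
  hnorm n psi = Num.sqrt (n%:R^-1 * norm2 psi).
Proof. by []. Qed.

Lemma enorm2D_le (R : realType) (u v : wavefun R) :
  cmeasurable (u : plane R -> R[i]) -> cmeasurable (v : plane R -> R[i]) ->
  (enorm2 (fun z => (u z + v z)%R) <= 2%:E * enorm2 u + 2%:E * enorm2 v)%E.
Proof.
move=> mu mv; rewrite /enorm2 -!ge0_integralZl//=; last 4 first.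
- exact/measurable_EFinP/cmeasurable_sqnorm.
- by move=> x _; rewrite lee_fin sqnorm_ge0.
- exact/measurable_EFinP/cmeasurable_sqnorm.
- by move=> x _; rewrite lee_fin sqnorm_ge0.
have mk (w : plane R -> R[i]) : cmeasurable w ->
   measurable_fun setT (fun z => 2%:E * (sqnorm (w z))%:E)%E.
  by move=> mw; apply/measurable_EFinP/measurable_funM => //; exact/cmeasurable_sqnorm.
rewrite -ge0_integralD//=; last 4 first.
- by move=> x _; rewrite lee_fin mulr_ge0// sqnorm_ge0.
- exact: mk.
- by move=> x _; rewrite lee_fin mulr_ge0// sqnorm_ge0.
- exact: mk.
apply: ge0_le_integral => //=.
- by move=> x _; rewrite lee_fin sqnorm_ge0.
- exact/measurable_EFinP/cmeasurable_sqnorm/cmeasurableD.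
- by apply: emeasurable_funD; exact: mk.
- by move=> x _; rewrite lee_fin sqnormD.
Qed.

Lemma enorm2Z (R : realType) c (u : wavefun R) : cmeasurable (u : plane R -> R[i]) ->
  enorm2 (fun z => c * u z) = ((sqnorm c)%:E * enorm2 u)%E.
Proof.
move=> mu; rewrite /enorm2 -ge0_integralZl//=.
- by apply: eq_integral => z _; rewrite sqnormM.
- exact/measurable_EFinP/cmeasurable_sqnorm.
- by move=> x _; rewrite lee_fin sqnorm_ge0.
- by rewrite lee_fin sqnorm_ge0.
Qed.

Lemma measurable_rot (R : realType) (t : R) :
  measurable_fun [set: plane R] (rot t : plane R -> plane R).
Proof. by have [] := rot_preserving t. Qed.

Lemma ge0_integral_preserving d (T : measurableType d) (R : realType)
    (mu : {measure set T -> \bar R}) (h : T -> T) (f : T -> \bar R) :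
  measure_preserving mu h ->
  measurable_fun setT f -> (forall z, 0 <= f z)%E ->
  (\int[mu]_z f (h z) = \int[mu]_z f z)%E.
Proof.
move=> [mh eh] mf f0.
transitivity (\int[pushforward mu h]_z f z)%E.
  by rewrite ge0_integral_pushforward.
by apply: eq_measure_integral => A mA _; exact: eh.
Qed.

Lemma integral_preserving d (T : measurableType d) (R : realType)
    (mu : {measure set T -> \bar R}) (h : T -> T) (f : T -> \bar R) :
  measure_preserving mu h -> measurable_fun setT f ->
  (\int[mu]_z f (h z) = \int[mu]_z f z)%E.
Proof.
move=> hP mf; rewrite integralE [RHS]integralE; congr (_ - _)%E.
  rewrite -(ge0_integral_preserving hP (measurable_funepos mf) (funepos_ge0 f)).
  by apply: eq_integral => z _; rewrite !funeposE.
rewrite -(ge0_integral_preserving hP (measurable_funeneg mf) (funeneg_ge0 f)).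
by apply: eq_integral => z _; rewrite !funenegE.
Qed.

Lemma enorm2_rot (R : realType) (t : R) (u : wavefun R) :
  cmeasurable (u : plane R -> R[i]) -> enorm2 (fun z => u (rot t z)) = enorm2 u.
Proof.
move=> mu; rewrite /enorm2.
rewrite (ge0_integral_preserving (f :=
  fun z => (sqnorm (u z))%:E) (rot_preserving t))//.
  exact/measurable_EFinP/cmeasurable_sqnorm.
by move=> z; rewrite lee_fin sqnorm_ge0.
Qed.

Lemma ae_rot (R : realType) (t : R) (P : plane R -> Prop) :
  {ae plane_measure R, forall z, P z} -> {ae plane_measure R, forall z, P (rot t z)}.
Proof.
move=> [A [mA A0 PA]]; have [mr er] := rot_preserving t.
exists (rot t @^-1` A); split.
- by rewrite -[X in measurable X]setTI; exact: mr.
- by rewrite [LHS]er.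
- by move=> z /= nP; exact: PA.
Qed.

Lemma sqiD (R : realType) (u v : wavefun R) : square_integrable u ->
  square_integrable v -> square_integrable (fun z => u z + v z).
Proof.
move=> /sqiP[mu hu] /sqiP[mv hv]; apply/sqiP; split; first exact: cmeasurableD.
by apply: le_lt_trans (enorm2D_le mu mv) _; rewrite lte_add_pinfty// lte_mul_pinfty.
Qed.

Lemma sqiZ (R : realType) c (u : wavefun R) : square_integrable u ->
  square_integrable (fun z => c * u z).
Proof.
move=> /sqiP[mu hu]; apply/sqiP; split; first exact: cmeasurableZ.
by rewrite enorm2Z// lte_mul_pinfty// lee_fin sqnorm_ge0.
Qed.

Lemma sqiN (R : realType) (u : wavefun R) : square_integrable u ->
  square_integrable (fun z => - u z).
Proof.
move=> /(sqiZ (-1)); congr square_integrable.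
by apply/funext => z; rewrite mulN1r.
Qed.

Lemma sqiB (R : realType) (u v : wavefun R) : square_integrable u ->
  square_integrable v -> square_integrable (fun z => u z - v z).
Proof. by move=> su sv; exact: sqiD su (sqiN sv). Qed.

Lemma sqi_rot (R : realType) t (u : wavefun R) : square_integrable u ->
  square_integrable (fun z => u (rot t z)).
Proof.
move=> /sqiP[mu hu]; apply/sqiP; split; last by rewrite enorm2_rot.
exact: (cmeasurable_comp mu (measurable_rot t)).
Qed.

Lemma norm2D_le (R : realType) (u v : wavefun R) : square_integrable u ->
  square_integrable v -> norm2 (fun z => u z + v z) <= 2 * norm2 u + 2 * norm2 v.
Proof.
move=> su sv; rewrite -lee_fin EFinD !EFinM !norm2E//; last exact: sqiD.
by apply: enorm2D_le; [have /sqiP[] := su|have /sqiP[] := sv].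
Qed.

Lemma norm2Z (R : realType) c (u : wavefun R) : square_integrable u ->
  norm2 (fun z => c * u z) = sqnorm c * norm2 u.
Proof.
move=> su; apply/EFin_inj; rewrite EFinM !norm2E//; last exact: sqiZ.
by apply: enorm2Z; have /sqiP[] := su.
Qed.

Lemma norm2N (R : realType) (u : wavefun R) : norm2 (fun z => - u z) = norm2 u.
Proof. by apply: eq_Rintegral => z _; rewrite sqnormN. Qed.

Lemma norm2B_le (R : realType) (u v : wavefun R) : square_integrable u ->
  square_integrable v -> norm2 (fun z => u z - v z) <= 2 * norm2 u + 2 * norm2 v.
Proof. by move=> su sv; rewrite -(norm2N v); apply: norm2D_le => //; exact: sqiN. Qed.

Lemma norm2_rot (R : realType) t (u : wavefun R) : square_integrable u ->
  norm2 (fun z => u (rot t z)) = norm2 u.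
Proof.
move=> su; apply/EFin_inj; rewrite !norm2E//; last exact: sqi_rot.
by apply: enorm2_rot; have /sqiP[] := su.
Qed.

Lemma ae_plane_mono (R : realType) (P Q : plane R -> Prop) :
  (forall z, P z -> Q z) -> {ae plane_measure R, forall z, P z} ->
  {ae plane_measure R, forall z, Q z}.
Proof. by move=> PQ; apply: filterS. Qed.

Lemma ae_plane_mono2 (R : realType) (P Q S : plane R -> Prop) :
  (forall z, P z -> Q z -> S z) -> {ae plane_measure R, forall z, P z} ->
  {ae plane_measure R, forall z, Q z} -> {ae plane_measure R, forall z, S z}.
Proof. by move=> PQ; apply: filterS2. Qed.

Lemma eq_ae_norm2 (R : realType) (u v : wavefun R) :
  cmeasurable (u : plane R -> R[i]) -> cmeasurable (v : plane R -> R[i]) ->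
  eq_ae u v -> norm2 u = norm2 v.
Proof.
move=> mu mv uv; congr fine; apply: ae_eq_integral => //.
- exact/measurable_EFinP/cmeasurable_sqnorm.
- exact/measurable_EFinP/cmeasurable_sqnorm.
- by apply: filterS uv => z /= -> _.
Qed.

Lemma enorm2_eq0 (R : realType) (u : wavefun R) : cmeasurable (u : plane R -> R[i]) ->
  enorm2 u = 0%E -> eq_ae u (fun=> 0).
Proof.
move=> mu h.
have /ae_eq_integral_abs : measurable_fun [set: plane R]
    (fun z => (sqnorm (u z))%:E) by exact/measurable_EFinP/cmeasurable_sqnorm.
move=> /(_ (plane_measure R) measurableT)[+ _].
have -> : (\int[plane_measure R]_x `|(sqnorm (u x))%:E| = enorm2 u)%E.
  by apply: eq_integral => z _; rewrite /= ger0_norm// sqnorm_ge0.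
move=> /(_ h); apply: filterS => z /(_ I) /= [] /eqP.
by rewrite sqnorm_eq0 => /eqP.
Qed.

Lemma norm2_eq0 (R : realType) (u : wavefun R) : square_integrable u ->
  norm2 u = 0 -> eq_ae u (fun=> 0).
Proof.
move=> su u0; apply: enorm2_eq0; first by have /sqiP[] := su.
by rewrite -norm2E// u0.
Qed.

(** [inner] without the factor $1/n$, which cancels from both sides of an adjointness relation. *)
Definition ip (R : realType) (u v : wavefun R) : R[i] :=
  cintegral (fun z => (u z)^*%C * v z).

Lemma innerE (R : realType) n (u v : wavefun R) :
  inner n u v = (n%:R^-1)%:C%C * ip u v.
Proof. by []. Qed.

Lemma sqi_integrable (R : realType) (u : wavefun R) : square_integrable u ->
  (plane_measure R).-integrable setT (fun z => (sqnorm (u z))%:E).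
Proof.
move=> /sqiP[mu hu]; apply/integrableP; split.
  exact/measurable_EFinP/cmeasurable_sqnorm.
apply: le_lt_trans hu; rewrite le_eqVlt; apply/orP; left; apply/eqP.
by apply: eq_integral => z _; rewrite /= ger0_norm// sqnorm_ge0.
Qed.

Lemma norm_Re_conjM_le (R : realType) (c : R) (x y : R[i]) : 0 < c ->
  `|complex.Re (x^*%C * y)| <= c * sqnorm x + c^-1 * sqnorm y.
Proof. by move=> c0; rewrite !ReImE mulNr opprK; exact: norm_dot2_le. Qed.

Lemma norm_Im_conjM_le (R : realType) (c : R) (x y : R[i]) : 0 < c ->
  `|complex.Im (x^*%C * y)| <= c * sqnorm x + c^-1 * sqnorm y.
Proof.
move=> c0; rewrite !ReImE mulNr -mulrN /sqnorm.
by rewrite [X in _ + c^-1 * X]addrC -(sqrrN (complex.Re y)); exact: norm_dot2_le.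
Qed.

Lemma sqi_conjM_cintegrable (R : realType) (u v : wavefun R) : square_integrable u ->
  square_integrable v ->
  cintegrable (plane_measure R) setT (fun z => (u z)^*%C * v z).
Proof.
move=> su sv; have /sqiP[mu _] := su; have /sqiP[mv _] := sv.
have [mr mi] := cmeasurableM (cmeasurableC mu) mv.
split.
  apply: (le_integrable measurableT _ _
    (integrableD measurableT (sqi_integrable su) (sqi_integrable sv))).
    exact/measurable_EFinP.
  move=> z _ /=; rewrite lee_fin [leRHS]ger0_norm; last first.
    by rewrite addr_ge0// sqnorm_ge0.
  have := @norm_Re_conjM_le _ 1 (u z) (v z) ltr01.
  by rewrite invr1 !mul1r.
apply: (le_integrable measurableT _ _
  (integrableD measurableT (sqi_integrable su) (sqi_integrable sv))).
  exact/measurable_EFinP.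
move=> z _ /=; rewrite lee_fin [leRHS]ger0_norm; last first.
  by rewrite addr_ge0// sqnorm_ge0.
have := @norm_Im_conjM_le _ 1 (u z) (v z) ltr01.
by rewrite invr1 !mul1r.
Qed.

Lemma ipDr (R : realType) (u v w : wavefun R) : square_integrable u ->
  square_integrable v -> square_integrable w ->
  ip u (fun z => v z + w z) = ip u v + ip u w.
Proof.
move=> su sv sw; rewrite -(cintD measurableT); last 2 first.
- exact: sqi_conjM_cintegrable.
- exact: sqi_conjM_cintegrable.
by apply: eq_cint => z _; rewrite mulrDr.
Qed.

Lemma ipZr (R : realType) c (u v : wavefun R) : square_integrable u ->
  square_integrable v -> ip u (fun z => c * v z) = c * ip u v.
Proof.
move=> su sv; rewrite -(cintZ measurableT); last exact: sqi_conjM_cintegrable.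
by apply: eq_cint => z _; rewrite mulrCA.
Qed.

Lemma ipDl (R : realType) (u v w : wavefun R) : square_integrable u ->
  square_integrable v -> square_integrable w ->
  ip (fun z => u z + v z) w = ip u w + ip v w.
Proof.
move=> su sv sw; rewrite -(cintD measurableT); last 2 first.
- exact: sqi_conjM_cintegrable.
- exact: sqi_conjM_cintegrable.
by apply: eq_cint => z _; apply: complexP; rewrite !ReImE; ring.
Qed.

Lemma ipZl (R : realType) c (u v : wavefun R) : square_integrable u ->
  square_integrable v -> ip (fun z => c * u z) v = c^*%C * ip u v.
Proof.
move=> su sv; rewrite -(cintZ measurableT); last exact: sqi_conjM_cintegrable.
by apply: eq_cint => z _; apply: complexP; rewrite !ReImE; ring.
Qed.

Lemma ipBr (R : realType) (u v w : wavefun R) : square_integrable u ->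
  square_integrable v -> square_integrable w ->
  ip u (fun z => v z - w z) = ip u v - ip u w.
Proof.
move=> su sv sw; rewrite ipDr//; last exact: sqiN.
congr (_ + _); rewrite -mulN1r -ipZr//.
by congr ip; apply/funext => z; rewrite mulN1r.
Qed.

Lemma ipBl (R : realType) (u v w : wavefun R) : square_integrable u ->
  square_integrable v -> square_integrable w ->
  ip (fun z => u z - v z) w = ip u w - ip v w.
Proof.
move=> su sv sw; rewrite ipDl//; last exact: sqiN.
congr (_ + _); transitivity ((-1)^*%C * ip v w).
  by rewrite -ipZl//; congr ip; apply/funext => z; rewrite mulN1r.
by apply: complexP; rewrite !ReImE /=; ring.
Qed.

Lemma ip_rot (R : realType) t (u v : wavefun R) : square_integrable u ->
  square_integrable v ->
  ip (fun z => u (rot t z)) (fun z => v (rot t z)) = ip u v.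
Proof.
move=> /sqiP[mu _] /sqiP[mv _].
have [mr mi] := cmeasurableM (cmeasurableC mu) mv.
congr Complex; congr fine.
  exact: (integral_preserving (f := fun z => (complex.Re ((u z)^*%C * v z))%:E)
    (rot_preserving t) ((measurable_EFinP _ _).2 mr)).
exact: (integral_preserving (f := fun z => (complex.Im ((u z)^*%C * v z))%:E)
    (rot_preserving t) ((measurable_EFinP _ _).2 mi)).
Qed.

(** The free weight [c] stands in for the product of norms: a pairing is small once one squared norm
    is small compared with the bound on the other. *)
Lemma Re_ip_le (R : realType) (c : R) (u v : wavefun R) : 0 < c ->
  square_integrable u -> square_integrable v ->
  `|complex.Re (ip u v)| <= c * norm2 u + c^-1 * norm2 v.
Proof.
move=> c0 su sv; have [ir _] := sqi_conjM_cintegrable su sv.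
have iu := sqi_integrable su; have iv := sqi_integrable sv.
apply: le_trans (le_normr_Rintegral measurableT ir) _.
rewrite -!RintegralZl//= -RintegralD//=; last 2 first.
- exact: (integrableZl measurableT c iu).
- exact: (integrableZl measurableT c^-1 iv).
apply: le_Rintegral => //; first exact: (integrable_abse ir).
- exact: (integrableD measurableT (integrableZl measurableT c iu)
    (integrableZl measurableT c^-1 iv)).
- by move=> z _; exact: norm_Re_conjM_le.
Qed.

Lemma Im_ip_le (R : realType) (c : R) (u v : wavefun R) : 0 < c ->
  square_integrable u -> square_integrable v ->
  `|complex.Im (ip u v)| <= c * norm2 u + c^-1 * norm2 v.
Proof.
move=> c0 su sv; have [_ ii] := sqi_conjM_cintegrable su sv.
have iu := sqi_integrable su; have iv := sqi_integrable sv.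
apply: le_trans (le_normr_Rintegral measurableT ii) _.
rewrite -!RintegralZl//= -RintegralD//=; last 2 first.
- exact: (integrableZl measurableT c iu).
- exact: (integrableZl measurableT c^-1 iv).
apply: le_Rintegral => //; first exact: (integrable_abse ii).
- exact: (integrableD measurableT (integrableZl measurableT c iu)
    (integrableZl measurableT c^-1 iv)).
- by move=> z _; exact: norm_Im_conjM_le.
Qed.

Lemma ip_self (R : realType) (u : wavefun R) : complex.Re (ip u u) = norm2 u.
Proof.
by apply: eq_Rintegral => z _; rewrite !ReImE /sqnorm; ring.
Qed.

Lemma eq_ae_ipl (R : realType) (u u' v : wavefun R) : square_integrable u ->
  square_integrable u' -> square_integrable v -> eq_ae u u' ->
  ip u v = ip u' v.
Proof.
move=> /sqiP[mu _] /sqiP[mu' _] /sqiP[mv _] uu'.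
have [mr mi] := cmeasurableM (cmeasurableC mu) mv.
have [mr' mi'] := cmeasurableM (cmeasurableC mu') mv.
congr Complex; congr fine; apply: ae_eq_integral => //; do ?exact/measurable_EFinP.
  by apply: filterS uu' => z /= -> _.
by apply: filterS uu' => z /= -> _.
Qed.

Lemma sector_sqi (R : realType) n a (u : wavefun R) : sector n a u ->
  square_integrable u.
Proof. by case. Qed.

Lemma sectorZ (R : realType) n a c (u : wavefun R) : sector n a u ->
  sector n a (fun z => c * u z).
Proof.
move=> [su eu]; split; first exact: sqiZ.
by apply: (ae_plane_mono _ eu) => z ->; rewrite mulrCA.
Qed.

Lemma sectorB (R : realType) n a (u v : wavefun R) : sector n a u ->
  sector n a v -> sector n a (fun z => u z - v z).
Proof.
move=> [su eu] [sv ev]; split; first exact: sqiB.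
by apply: (ae_plane_mono2 _ eu ev) => z -> ->; rewrite mulrBr.
Qed.

Lemma sector_rot (R : realType) n a t (u : wavefun R) : sector n a u ->
  sector n a (fun z => u (rot t z)).
Proof.
move=> [su eu]; split; first exact: sqi_rot.
by apply: (ae_plane_mono _ (ae_rot t eu)) => z; rewrite -!rotD addrC.
Qed.

(** * Skew-symmetry of the generator *)

(** Trades the limit of [hnorm] in the definition of the generator for an epsilon-delta statement
    about [norm2]. *)
Lemma sqrt_cvg0P (R : realType) (k : R) (f : R -> R) : 0 < k ->
  (forall t, 0 <= f t) ->
  (Num.sqrt (k * f t) @[t --> (0 : R)^'] --> (0 : R)) <->
  (forall e, 0 < e -> exists2 d : R, 0 < d &
     forall t, t != 0 -> `|t| < d -> f t < e).
Proof.
move=> k0 f0; split=> [h e e0|h].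
  have ke0 : 0 < Num.sqrt (k * e) by rewrite sqrtr_gt0 mulr_gt0.
  have /(_ _ _ ke0) := (@cvgrPdist_lt _ _ _ _ _ _ _).1 h.
  rewrite /dnbhs /within /= => /nbhs_ballP[d /= d0 hd].
  exists d => // t t0 td; have := hd t; rewrite /ball /= sub0r normrN => /(_ td t0).
  by rewrite sub0r normrN ger0_norm ?sqrtr_ge0// ltr_sqrt ?mulr_gt0// ltr_pM2l.
apply/cvgrPdist_lt => e e0.
have [|d d0 hd] := h (k^-1 * e ^+ 2); first by rewrite mulr_gt0 ?invr_gt0 ?exprn_gt0.
rewrite /dnbhs /within /=; apply/nbhs_ballP; exists d => //= t.
rewrite /ball /= sub0r normrN => td t0.
rewrite sub0r normrN ger0_norm ?sqrtr_ge0//.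
rewrite -[ltRHS](gtr0_norm e0) -sqrtr_sqr ltr_sqrt ?exprn_gt0//.
by rewrite -ltr_pdivlMl//; exact: hd.
Qed.

Lemma rotation_generatorP (R : realType) n a (psi delta : wavefun R) :
  (0 < n)%N ->
  rotation_generator n a psi delta <->
  [/\ sector n a psi, sector n a delta &
   forall e, 0 < e -> exists2 d : R, 0 < d & forall t, t != 0 -> `|t| < d ->
     norm2 (fun z => (t^-1)%:C%C * (psi (rot t z) - psi z) - delta z) < e].
Proof.
move=> n0.
have k0 : 0 < n%:R^-1 :> R by rewrite invr_gt0 ltr0n.
have E := sqrt_cvg0P k0 (fun t => norm2_ge0
  (fun z => (t^-1)%:C%C * (psi (rot t z) - psi z) - delta z)).
by split=> -[sp sd /E h].
Qed.

Definition quot (R : realType) t (psi : wavefun R) : wavefun R :=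
  fun z => (t^-1)%:C%C * (psi (rot t z) - psi z).

Lemma sector_quot (R : realType) n a t (psi : wavefun R) : sector n a psi ->
  sector n a (quot t psi).
Proof. by move=> sp; apply/sectorZ/sectorB => //; exact: sector_rot. Qed.

(** Unitarity turns $U(t)$ on the right into $U(-t)$ on the left; the sign comes from $1/t$. *)
Lemma ip_quot (R : realType) t (u v : wavefun R) : square_integrable u ->
  square_integrable v -> ip u (quot t v) = - ip (quot (- t) u) v.
Proof.
move=> su sv.
have sru := sqi_rot (- t) su; have srv := sqi_rot t sv.
rewrite ipZr ?ipBr//; last exact: sqiB.
rewrite ipZl ?ipBl//; last exact: sqiB.
have -> : ip u (fun z => v (rot t z)) = ip (fun z => u (rot (- t) z)) v.
  rewrite -(ip_rot t (sqi_rot (- t) su) sv).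
  by congr ip; apply/funext => z; rewrite rotK.
by rewrite invrN; apply: complexP; rewrite !ReImE /=; ring.
Qed.

Lemma small_eq0 (R : realType) (C x : R) :
  (forall c e, 0 < c -> 0 < e -> `|x| <= c * C + c^-1 * e) -> x = 0.
Proof.
move=> h; apply/eqP; rewrite -normr_le0; apply/ler_addgt0Pl => e e0.
have C1 : 0 < `|C| + 1 by rewrite ltr_wpDl.
(* This weight makes $cC\le e/2$, and the error $ce/2$ contributes exactly $e/2$; adding 1 to [|C|]
   keeps the denominator positive. *)
pose c := e / (2 * (`|C| + 1)).
have c0 : 0 < c by rewrite divr_gt0// mulr_gt0.
apply: (le_trans (h c (c * e / 2) c0 _)); first by rewrite !mulr_gt0// invr_gt0.
rewrite addr0 -mulrA mulKf ?gt_eqF// [leRHS](splitr e) lerD2r.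
rewrite /c ler_pdivlMr// mulrAC.
apply: (@le_trans _ _ (e * (`|C| + 1) / (2 * (`|C| + 1)) * 2)); last first.
  by rewrite le_eqVlt; apply/orP; left; apply/eqP; field; rewrite gt_eqF.
rewrite (_ : _ * (_ + 1) / _ * 2 = e / (2 * (`|C| + 1)) * 2 * (`|C| + 1)); last by ring.
rewrite ler_pM2l; last by rewrite mulr_gt0// divr_gt0// mulr_gt0.
by rewrite ler_wpDr// ler_norm.
Qed.

Lemma complex_small_eq0 (R : realType) (C : R) (x : R[i]) :
  (forall c e, 0 < c -> 0 < e ->
    `|complex.Re x| <= c * C + c^-1 * e /\
    `|complex.Im x| <= c * C + c^-1 * e) -> x = 0.
Proof.
move=> h; apply: complexP => /=.
  by apply: (@small_eq0 _ C) => c e c0 e0; have [] := h c e c0 e0.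
by apply: (@small_eq0 _ C) => c e c0 e0; have [] := h c e c0 e0.
Qed.

(* Passing to the limit in <u, q_t v> = - <q_{-t} u, v> for the difference
   quotients q_t. *)
Lemma generator_skew (R : realType) n a (u u' v v' : wavefun R) : (0 < n)%N ->
  rotation_generator n a u u' -> rotation_generator n a v v' ->
  ip u v' = - ip u' v.
Proof.
move=> n0 /(rotation_generatorP _ _ _ n0)[[su _] [su' _] hu].
move=> /(rotation_generatorP _ _ _ n0)[[sv _] [sv' _] hv].
have sq t w : square_integrable w -> square_integrable (quot t w).
  by move=> sw; apply/sqiZ/sqiB => //; exact: sqi_rot.
apply/eqP; rewrite -addr_eq0; apply/eqP.
apply: (@complex_small_eq0 _ (norm2 u + norm2 v)) => c e c0 e0.
have [du du0 {}hu] := hu (e / 2) (divr_gt0 e0 (ltr0n _ 2)).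
have [dv dv0 {}hv] := hv (e / 2) (divr_gt0 e0 (ltr0n _ 2)).
pose t := Num.min du dv / 2.
have m0 : 0 < Num.min du dv by rewrite lt_min du0.
have t0 : 0 < t by rewrite divr_gt0.
have tm : t < Num.min du dv by rewrite /t ltr_pdivrMr//; lra.
have hu1 : norm2 (fun z => quot (- t) u z - u' z) < e / 2.
  apply: hu; first by rewrite oppr_eq0 gt_eqF.
  by rewrite normrN gtr0_norm// (lt_le_trans tm)// ge_min lexx.
have hv1 : norm2 (fun z => quot t v z - v' z) < e / 2.
  apply: hv; first by rewrite gt_eqF.
  by rewrite gtr0_norm// (lt_le_trans tm)// ge_min lexx orbT.
have sU : square_integrable (fun z => quot (- t) u z - u' z)
  by apply: sqiB => //; exact: sq.
have sV : square_integrable (fun z => quot t v z - v' z) by apply: sqiB => //;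
  exact: sq.
(* The two pairings with difference quotients cancel by [ip_quot], so only pairings with the
   approximation errors remain. *)
have -> : ip u v' + ip u' v =
   - (ip u (fun z => quot t v z - v' z) + ip (fun z => quot (- t) u z - u' z) v).
  rewrite ipBr//; last exact: sq.
  rewrite ipBl//; last exact: sq.
  by rewrite ip_quot//; ring.
have Nv (w : wavefun R) : square_integrable w -> norm2 w < e / 2 ->
    c^-1 * norm2 w <= c^-1 * (e / 2).
  by move=> _ /ltW he; rewrite ler_pM2l ?invr_gt0.
have c1 : 0 < c^-1 by rewrite invr_gt0.
have E : c * (norm2 u + norm2 v) + c^-1 * e =
    (c * norm2 u + c^-1 * (e / 2)) + (c^-1 * (e / 2) + c * norm2 v) by field;
      rewrite gt_eqF.
rewrite !ReImE !normrN E; split; apply: (le_trans (ler_normD _ _)); apply: lerD.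
- by apply: le_trans (Re_ip_le c0 su sV) _; rewrite lerD2l Nv.
- by apply: le_trans (Re_ip_le c1 sU sv) _; rewrite invrK lerD2r Nv.
- by apply: le_trans (Im_ip_le c0 su sV) _; rewrite lerD2l Nv.
- by apply: le_trans (Im_ip_le c1 sU sv) _; rewrite invrK lerD2r Nv.
Qed.

Lemma norm2_mono (R : realType) (u v : wavefun R) :
  cmeasurable (u : plane R -> R[i]) -> square_integrable v ->
  (forall z, sqnorm (u z) <= sqnorm (v z)) ->
  square_integrable u /\ norm2 u <= norm2 v.
Proof.
move=> mu sv uv; have /sqiP[mv hv] := sv.
have h : (enorm2 u <= enorm2 v)%E.
  apply: ge0_le_integral => //.
  - by move=> z _; rewrite lee_fin sqnorm_ge0.
  - exact/measurable_EFinP/cmeasurable_sqnorm.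
  - exact/measurable_EFinP/cmeasurable_sqnorm.
  - by move=> z _; rewrite lee_fin.
have su : square_integrable u by apply/sqiP; split => //; exact: le_lt_trans hv.
by split=> //; rewrite -lee_fin !norm2E.
Qed.

(** * Strong continuity of rotations *)

Definition rot_continuous (R : realType) (u : wavefun R) :=
  square_integrable u /\ forall e, 0 < e -> exists2 d : R, 0 < d &
    forall t, `|t| < d -> norm2 (fun z => u (rot t z) - u z) < e.

Lemma rot_continuousD (R : realType) (u v : wavefun R) :
  rot_continuous u -> rot_continuous v ->
  rot_continuous (fun z => u z + v z).
Proof.
move=> [su hu] [sv hv]; split; first exact: sqiD.
move=> e e0; have e4 : 0 < e / 4 by rewrite divr_gt0.
have [d d0 {}hu] := hu _ e4; have [d' d'0 {}hv] := hv _ e4.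
exists (Num.min d d'); first by rewrite lt_min d0.
move=> t; rewrite lt_min => /andP[/hu ut /hv vt].
have -> : (fun z => u (rot t z) + v (rot t z) - (u z + v z)) =
  (fun z => (u (rot t z) - u z) + (v (rot t z) - v z)).
  by apply/funext => z; ring.
apply: le_lt_trans (norm2D_le _ _) _; [by apply: sqiB => //; exact: sqi_rot..|].
lra.
Qed.

Lemma rot_continuousZ (R : realType) c (u : wavefun R) : rot_continuous u ->
  rot_continuous (fun z => c * u z).
Proof.
move=> [su hu]; split; first exact: sqiZ.
move=> e e0; have c1 : 0 < sqnorm c + 1 by rewrite ltr_wpDl// sqnorm_ge0.
have e4 : 0 < e / (sqnorm c + 1) by rewrite divr_gt0.
have [d d0 {}hu] := hu _ e4; exists d => // t /hu ut.
have -> : (fun z => c * u (rot t z) - c * u z) =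
  (fun z => c * (u (rot t z) - u z)).
  by apply/funext => z; ring.
rewrite norm2Z; last by apply: sqiB => //; exact: sqi_rot.
rewrite ltr_pdivlMr// in ut; apply: le_lt_trans ut.
by rewrite mulrC ler_wpM2l ?norm2_ge0// lerDl.
Qed.

Lemma rot_continuousB (R : realType) (u v : wavefun R) :
  rot_continuous u -> rot_continuous v ->
  rot_continuous (fun z => u z - v z).
Proof.
move=> cu cv; have := rot_continuousD cu (rot_continuousZ (-1) cv);
  congr rot_continuous.
by apply/funext => z; rewrite mulN1r.
Qed.

Lemma rot_continuous_rot (R : realType) s (u : wavefun R) : rot_continuous u ->
  rot_continuous (fun z => u (rot s z)).
Proof.
move=> [su hu]; split; first exact: sqi_rot.
move=> e e0; have [d d0 {}hu] := hu _ e0; exists d => // t /hu ut.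
have sut : square_integrable (fun z => u (rot t z) - u z).
  by apply: sqiB => //; exact: sqi_rot.
rewrite -(norm2_rot s sut) in ut; apply: le_lt_trans ut.
rewrite le_eqVlt; apply/orP; left; apply/eqP; congr norm2; apply/funext => z.
by rewrite -!rotD (addrC s).
Qed.

(** A three-term estimate: rotations are isometric, so [v] approximates [u] equally well after
    rotation. *)
Lemma rot_continuous_closed (R : realType) (u : wavefun R) : square_integrable u ->
  (forall e, 0 < e -> exists2 v, rot_continuous v & norm2 (fun z => u z - v z) < e) ->
  rot_continuous u.
Proof.
move=> su h; split=> // e e0.
(* The nested splitting costs the factors 2, 4 and 4, which sum to less than 12. *)
have e8 : 0 < e / 12 by rewrite divr_gt0.
have [v [sv hv] uv] := h _ e8; have [d d0 {}hv] := hv _ e8.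
exists d => // t /hv vt.
have suv := sqiB su sv; have svu := sqiB (sqi_rot t sv) sv.
have -> : (fun z => u (rot t z) - u z) =
  (fun z => (u (rot t z) - v (rot t z)) + ((v (rot t z) - v z) - (u z - v z))).
  by apply/funext => z; ring.
apply: le_lt_trans (norm2D_le (sqi_rot t suv) (sqiB svu suv)) _.
have := norm2B_le svu suv; rewrite (norm2_rot t suv); lra.
Qed.

(** The unit bounds make multiplication by either factor a contraction of $L^2$. Applied to
    indicators, this handles intersections of sets. *)
Lemma rot_continuousM (R : realType) (u v : wavefun R) :
  rot_continuous u -> rot_continuous v ->
  (forall z, sqnorm (u z) <= 1) -> (forall z, sqnorm (v z) <= 1) ->
  rot_continuous (fun z => u z * v z).
Proof.
move=> [su hu] [sv hv] u1 v1.
have bnd (w f : wavefun R) : cmeasurable (w : plane R -> R[i]) ->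
    (forall z, sqnorm (w z) <= 1) -> square_integrable f ->
    square_integrable (fun z => w z * f z) /\ norm2 (fun z => w z * f z) <= norm2 f.
  move=> mw w1 sf; apply: norm2_mono => //.
    by apply: cmeasurableM => //; have /sqiP[] := sf.
  by move=> z; rewrite sqnormM ler_piMl// sqnorm_ge0.
have /sqiP[mu _] := su; have /sqiP[mv _] := sv.
split; first by have [] := bnd _ _ mu u1 sv.
move=> e e0; have e4 : 0 < e / 4 by rewrite divr_gt0.
have [d d0 {}hu] := hu _ e4; have [d' d'0 {}hv] := hv _ e4.
exists (Num.min d d'); first by rewrite lt_min d0.
move=> t; rewrite lt_min => /andP[/hu ut /hv vt].
have -> : (fun z => u (rot t z) * v (rot t z) - u z * v z) =
  (fun z => u (rot t z) * (v (rot t z) - v z) + v z * (u (rot t z) - u z)).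
  by apply/funext => z; ring.
have [s1 b1] := bnd _ _ (cmeasurable_comp mu (measurable_rot t)) (fun z => u1 _)
  (sqiB (sqi_rot t sv) sv).
have [s2 b2] := bnd _ _ mv v1 (sqiB (sqi_rot t su) su).
apply: le_lt_trans (norm2D_le s1 s2) _.
lra.
Qed.

Lemma cvg_norm2 (R : realType) (u g : wavefun R) (v : nat -> wavefun R) :
  cmeasurable (u : plane R -> R[i]) -> (forall k, cmeasurable (v k : plane R ->
    R[i])) ->
  square_integrable g ->
  (forall k z, sqnorm (u z - v k z) <= sqnorm (g z)) ->
  (forall z, sqnorm (u z - v k z) @[k --> \oo] --> (0 : R)) ->
  forall e, 0 < e -> exists k, norm2 (fun z => u z - v k z) < e.
Proof.
move=> mu mv sg dom cv e e0.
have mf k : measurable_fun [set: plane R] (fun z => (sqnorm (u z - v k z))%:E).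
  by apply/measurable_EFinP/cmeasurable_sqnorm/cmeasurableD => //; exact: cmeasurableN.
have cf : {ae plane_measure R, forall z, [set: plane R] z ->
    (sqnorm (u z - v k z))%:E @[k --> \oo] --> (0%:E : \bar R)}.
  apply: aeW => z _; apply: cvg_EFin; [exact: nearW|exact: cv].
have df : {ae plane_measure R, forall z k, [set: plane R] z ->
    (`|(sqnorm (u z - v k z))%:E| <= (sqnorm (g z))%:E)%E}.
  apply: aeW => z k _; rewrite /= lee_fin ger0_norm ?sqnorm_ge0//; exact: dom.
have [_ _] := @dominated_convergence _ _ R (plane_measure R) setT measurableT
  (fun k z => (sqnorm (u z - v k z))%:E) (fun=> 0%:E) (fun z => (sqnorm (g z))%:E)
  mf (measurable_cst _) cf (sqi_integrable sg) df.
rewrite integral0 => /fine_cvgP[_] /(@cvgrPdist_lt _ _ _ _ _ _ _) /(_ e e0) [k _ hk].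
exists k; have := hk k (leqnn k); rewrite /= sub0r normrN ger0_norm//.
exact: norm2_ge0.
Qed.

(** The truncation that makes indicators square-integrable. Being rotation invariant, it factors out
    of the difference between a function and its rotation. *)
Definition disc (R : realType) (M : R) : set (plane R) :=
  [set z | z.1 ^+ 2 + z.2 ^+ 2 <= M ^+ 2].

Definition cind (R : realType) (E : set (plane R)) : wavefun R :=
  fun z => (\1_E z)%:C%C.

Lemma rot_sq (R : realType) t (z : plane R) :
  (rot t z).1 ^+ 2 + (rot t z).2 ^+ 2 = z.1 ^+ 2 + z.2 ^+ 2.
Proof.
rewrite /rot /=; transitivity ((z.1 ^+ 2 + z.2 ^+ 2) * (cos t ^+ 2 + sin t ^+ 2)).
  by ring.
by rewrite cos2Dsin2 mulr1.
Qed.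

Lemma cmeasurable_cind (R : realType) (E : set (plane R)) : measurable E ->
  cmeasurable (cind E : plane R -> R[i]).
Proof. by move=> mE; split => /=; [exact: measurable_indic|exact: measurable_cst]. Qed.

Lemma sqnorm_cind (R : realType) (E : set (plane R)) z :
  sqnorm (cind E z) = \1_E z.
Proof.
rewrite sqnorm_real indicE; case: (z \in E); first by rewrite expr1n.
by rewrite expr0n.
Qed.

Lemma enorm2_cind (R : realType) (E : set (plane R)) : measurable E ->
  enorm2 (cind E) = plane_measure R E.
Proof.
move=> mE; transitivity (\int[plane_measure R]_z (\1_E z)%:E)%E.
  by apply: eq_integral => z _; rewrite sqnorm_cind.
by rewrite integral_indic// setIT.
Qed.

Lemma measurable_sqdist (R : realType) :
  measurable_fun [set: plane R] (fun z : plane R => z.1 ^+ 2 + z.2 ^+ 2).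
Proof.
apply: measurable_funD; apply: measurable_funX.
  exact: measurable_fst.
exact: measurable_snd.
Qed.

Lemma measurable_disc (R : realType) (M : R) : measurable (disc M).
Proof.
rewrite (_ : disc M = (fun z : plane R => z.1 ^+ 2 + z.2 ^+ 2) @^-1` `]-oo, M ^+ 2]).
  by rewrite -[X in measurable X]setTI; exact: measurable_sqdist.
by apply/seteqP; split => z; rewrite /disc /= in_itv.
Qed.

Lemma disc_sub (R : realType) (M : R) : 0 <= M ->
  disc M `<=` `[(- M), M] `*` `[(- M), M].
Proof.
move=> M0 z; rewrite /disc /= !in_itv /= -!ler_norml => h.
have := sqr_ge0 z.1; have := sqr_ge0 z.2 => h1 h2.
by split; rewrite -(@ler_pXn2r _ 2)// ?nnegrE ?normr_ge0// real_normK ?num_real//; lra.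
Qed.

Lemma rect_measure (R : realType) (a b c e : R) : a <= b -> c <= e ->
  plane_measure R (`[a, b] `*` `[c, e]) = ((b - a) * (e - c))%:E.
Proof.
have h (x y : R) : x <= y -> mu1 (`[x, y]%classic : set R) = (y - x)%:E.
  move=> xy; rewrite lebesgue_measure_itv /= lte_fin; case: ltP => // yx.
  by rewrite (@le_anti _ R x y) ?xy ?yx// subrr.
by move=> ab ce; rewrite /plane_measure product_measure1E//= !h// EFinM.
Qed.

Lemma sqi_cind (R : realType) (M : R) (E : set (plane R)) : 0 <= M ->
  measurable E -> E `<=` disc M -> square_integrable (cind E).
Proof.
move=> M0 mE EM; apply/sqiP; split; first exact: cmeasurable_cind.
rewrite enorm2_cind//; apply: (@le_lt_trans _ _
    (plane_measure R (`[(- M), M] `*` `[(- M), M]))).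
  apply: le_measure; rewrite ?inE//; first exact: measurableX.
  by apply: subset_trans (disc_sub M0).
by rewrite rect_measure ?ltry//; lra.
Qed.

Lemma indic_rot_disc (R : realType) t (M : R) (z : plane R) :
  \1_(disc M) (rot t z) = \1_(disc M) z :> R.
Proof. rewrite !indicE (_ : (rot t z \in disc M) = (z \in disc M))//.
by apply/idP/idP; rewrite !inE /disc /= rot_sq. Qed.

Lemma rot_continuous_disc (R : realType) (M : R) :
  0 <= M -> rot_continuous (cind (disc M)).
Proof.
move=> M0; split; first by apply: (@sqi_cind _ M) => //; exact: measurable_disc.
move=> e e0; exists 1 => // t _.
rewrite (_ : (fun z => _) = (fun=> 0)).
  by rewrite norm2_cst0.
by apply/funext => z; rewrite /cind indic_rot_disc subrr.
Qed.

Lemma cindI (R : realType) (E F : set (plane R)) z :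
  cind (E `&` F) z = cind E z * cind F z.
Proof.
rewrite /cind indicI /=; apply: complexP; rewrite !ReImE /=; ring.
Qed.

Lemma sqnorm_cind_le1 (R : realType) (E : set (plane R)) z :
  sqnorm (cind E z) <= 1.
Proof. by rewrite sqnorm_cind indicE; case: (_ \in _); rewrite ?ler01. Qed.

(** Complements are differences and intersections are products of indicators; countable unions
    follow by dominated convergence. Closure under intersection yields a full $\sigma$-algebra, so
    half-planes, which are not stable under intersection, can serve as generators. *)
Lemma rot_continuous_sigma_algebra (R : realType) (M : R) : 0 <= M ->
  sigma_algebra setT
    [set E | measurable E /\ rot_continuous (cind (E `&` disc M))].
Proof.
move=> M0; have cD := rot_continuous_disc M0; have mD := @measurable_disc R M.
have cC (E : set (plane R)) : rot_continuous (cind (E `&` disc M)) ->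
  rot_continuous (cind (~` E `&` disc M)).
  move=> cE; have := rot_continuousB cD cE; congr rot_continuous; apply/funext => z.
  rewrite !cindI /cind !indicE in_setC.
  by case: (z \in E); apply: complexP; rewrite !ReImE /=; ring.
have cI (E F : set (plane R)) : rot_continuous (cind (E `&` disc M)) ->
    rot_continuous (cind (F `&` disc M)) ->
      rot_continuous (cind ((E `&` F) `&` disc M)).
  move=> cE cF; have := rot_continuousM cE cF (sqnorm_cind_le1 _) (sqnorm_cind_le1 _).
  by congr rot_continuous; apply/funext => z; rewrite -cindI setIACA setIid.
have cU (E F : set (plane R)) : rot_continuous (cind (E `&` disc M)) ->
    rot_continuous (cind (F `&` disc M)) ->
      rot_continuous (cind ((E `|` F) `&` disc M)).
  move=> cE cF; rewrite -[E `|` F]setCK setCU; apply: (cC); apply: cI; exact: (cC).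
split.
- split=> //; have := rot_continuousZ 0 cD; congr rot_continuous; apply/funext => z.
  by rewrite mul0r set0I /cind indic0.
- move=> E [mE cE]; rewrite setTD; split; first exact: measurableC.
  exact: cC.
- move=> F hF.
  have mF k : measurable (F k) by have [] := hF k.
  have mU : measurable (\bigcup_k F k) by exact: bigcupT_measurable.
  split=> //.
  pose G k := \big[setU/set0]_(j < k) F j.
  have mG k : measurable (G k) by exact: bigsetU_measurable.
  have cG k : rot_continuous (cind (G k `&` disc M)).
    rewrite /G; elim: k => [|k IH].
      rewrite big_ord0; have := rot_continuousZ 0 cD; congr rot_continuous;
        apply/funext => z.
      by rewrite mul0r set0I /cind indic0.
    by rewrite big_ord_recr /=; apply: cU => //; have [] := hF k.
  have sU : square_integrable (cind (\bigcup_k F k `&` disc M)).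
    by apply: (sqi_cind M0) => [|z []//]; exact: measurableI.
  apply: rot_continuous_closed => // e e0.
  have [] := @cvg_norm2 R (cind (\bigcup_k F k `&` disc M)) (cind (disc M))
     (fun k => cind (G k `&` disc M)) _ _ _ _ _ e e0.
  + by apply: cmeasurable_cind; exact: measurableI.
  + by move=> k; apply: cmeasurable_cind; exact: measurableI.
  + by have [] := cD.
  + move=> k z; rewrite !cindI -mulrBl sqnormM ler_piMl ?sqnorm_ge0//.
    rewrite /cind !indicE; case: (_ \in _); case: (_ \in _);
      by rewrite /sqnorm /= !(subr0,sub0r,subrr,expr0n,expr1n,sqrrN,add0r,addr0)
        //= ?ler01.
  + move=> z; have [[k _ Fz]|nFz] := pselect ((\bigcup_k F k) z).
      apply: cvg_near_cst; exists k.+1 => // j /= kj.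
      rewrite !cindI -mulrBl /cind !indicE mem_set; last by exists k.
      rewrite mem_set ?subrr ?mul0r ?sqnorm0//.
      by rewrite /G -bigcup_mkord; exists k.
    apply: cvg_near_cst; apply: nearW => k.
    rewrite !cindI -mulrBl /cind !indicE memNset// memNset ?subrr ?mul0r ?sqnorm0//.
    by rewrite /G -bigcup_mkord => -[j _ Fj]; apply: nFz; exists j.
  + by move=> k hk; exists (cind (G k `&` disc M)).
Qed.

Lemma rot_continuous_halfplane (R : realType) (M c : R) : 0 <= M ->
  rot_continuous (cind ([set z : plane R | c < z.1] `&` disc M)).
Proof.
move=> M0; set H := [set z | _].
have mH : measurable H.
  rewrite (_ : H = fst @^-1` `]c, +oo[).
    by rewrite -[X in measurable X]setTI; exact: measurable_fst.
  by apply/seteqP; split => z; rewrite /H /= in_itv /= andbT.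
have mHM : measurable (H `&` disc M) by apply: measurableI => //;
  exact: measurable_disc.
have sH : square_integrable (cind (H `&` disc M)) by apply: (sqi_cind M0) => // z [].
split=> // e e0.
(* the indicator only changes in the strip |x - c| <= h *)
pose h := e / (8 * (M + 1)).
have h0 : 0 < h by rewrite divr_gt0// mulr_gt0//; lra.
(* [h'] is to bound $|1-\cos t|$ and $|\sin t|$; as $|x|,|y|\le M$ on the disc, the first coordinate
   then moves by less than [h]. *)
pose h' := h / (2 * (M + 1)).
have h'0 : 0 < h' by rewrite divr_gt0// mulr_gt0//; lra.
have [d d0 hd] : exists2 d : R, 0 < d & forall t, `|t| < d ->
    `|1 - cos t| < h' /\ `|sin t| < h'.
  have /(_ _ _ h'0) := (@cvgrPdist_lt _ _ _ _ _ _ _).1 (@continuous_cos R 0).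
  have /(_ _ _ h'0) := (@cvgrPdist_lt _ _ _ _ _ _ _).1 (@continuous_sin R 0).
  rewrite cos0 sin0 => hs hc.
  have : nbhs (0 : R) [set t | `|0 - sin t| < h' /\ `|1 - cos t| < h'].
    exact: filterI hs hc.
  move=> /nbhs_ballP[d /= d0 hd].
  exists d => // t td; have [] := hd t; first by rewrite /ball /= sub0r normrN.
  by rewrite sub0r normrN.
exists d => // t /hd[ct st].
(* The area $4hM$ of the strip is below [e] by the choice of [h]. *)
pose S := `[c - h, c + h] `*` `[(- M), M] : set (plane R).
have mS : measurable S by exact: measurableX.
have NS : norm2 (cind S) = 2 * h * (2 * M).
  apply/EFin_inj; rewrite norm2E.
    rewrite enorm2_cind// rect_measure; [congr EFin; ring|lra|lra].
  apply/sqiP; split; first exact: cmeasurable_cind.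
  by rewrite enorm2_cind// rect_measure ?ltry//; lra.
have sS : square_integrable (cind S).
  apply/sqiP; split; first exact: cmeasurable_cind.
  by rewrite enorm2_cind// rect_measure ?ltry//; lra.
apply: (@le_lt_trans _ _ (norm2 (cind S))); last first.
  rewrite NS /h; have -> : 2 * (e / (8 * (M + 1))) * (2 * M) = e * (M / (2 * (M + 1))).
    by field; lra.
  rewrite gtr_pMr// ltr_pdivrMr; lra.
apply: (norm2_mono _ _ _).2 => //.
  apply: cmeasurableD; last exact/cmeasurableN/cmeasurable_cind.
  by apply: (cmeasurable_comp _ (measurable_rot t)); exact: cmeasurable_cind.
move=> z; rewrite !(cindI H) /cind indic_rot_disc -mulrBl sqnormM.
have [/set_mem zM|zM] := boolP (z \in disc M); last first.
  by rewrite [X in _ * sqnorm X](_ : _ = 0) ?sqnorm0 ?mulr0 ?sqnorm_ge0// indicE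
    (negbTE zM).
have [/= z1 z2] := disc_sub M0 zM; rewrite !in_itv /= -!ler_norml in z1 z2.
rewrite [X in _ * sqnorm X](_ : _ = 1); last by rewrite indicE mem_set.
rewrite sqnorm1 mulr1.
have zt : `|(rot t z).1 - z.1| < h.
  rewrite (_ : _ - _ = - (z.1 * (1 - cos t) + z.2 * sin t));
    last by rewrite /rot /=; ring.
  rewrite normrN; apply: le_lt_trans (ler_normD _ _) _; rewrite !normrM.
  have : h = (M + 1) * h' + (M + 1) * h' by rewrite /h'; field; lra.
  have := ltW ct; have := ltW st => s1 c1 ->.
  apply: ltrD.
    apply: (@le_lt_trans _ _ (M * `|1 - cos t|)); first by rewrite ler_wpM2r.
    by apply: (@le_lt_trans _ _ (M * h')); [rewrite ler_wpM2l|rewrite ltr_pM2r//; lra].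
  apply: (@le_lt_trans _ _ (M * `|sin t|)); first by rewrite ler_wpM2r.
  by apply: (@le_lt_trans _ _ (M * h')); [rewrite ler_wpM2l|rewrite ltr_pM2r//; lra].
have [zS|zS] := boolP (z \in S).
  rewrite [leRHS](_ : _ = 1); last by rewrite indicE zS sqnorm1.
  rewrite !indicE; case: (_ \in _); case: (_ \in _);
    by rewrite /sqnorm /= !(subr0,sub0r,subrr,expr0n,expr1n,sqrrN,add0r,addr0)
      //= ?ler01.
rewrite [in leRHS]indicE (negbTE zS).
suff -> : \1_H (rot t z) = \1_H z :> R by rewrite subrr !sqnorm0.
have {}zS : (z.1 < c - h) || (c + h < z.1).
  move: zS; apply: contraNT; rewrite negb_or -!leNgt => /andP[a1 a2].
  by rewrite inE /S /=; split; rewrite /= in_itv /= ?a1 ?a2 -?ler_norml.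
rewrite !indicE (_ : (rot t z \in H) = (z \in H))//.
move: zt; rewrite ltr_norml => /andP[zt1 zt2].
have eH (w : plane R) : (w \in H) = (c < w.1) by apply/idP/idP; rewrite inE.
have aux (p q : R) : (q < c - h) || (c + h < q) -> - h < p - q -> p - q < h ->
    (c < p) = (c < q).
  by move=> /orP[] qc p1 p2; apply/idP/idP; lra.
by rewrite !eH; exact: aux zt1 zt2.
Qed.

(** Open rays generate the Borel sets of the line, and preimages under the two coordinates generate
    the product $\sigma$-algebra, so half-planes suffice. *)
Lemma rot_continuous_cind (R : realType) (M : R) (E : set (plane R)) : 0 <= M ->
  measurable E -> rot_continuous (cind (E `&` disc M)).
Proof.
move=> M0 mE.
pose G : set (set (plane R)) :=
  [set E | measurable E /\ rot_continuous (cind (E `&` disc M))].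
have [G0 GC GU] : sigma_algebra setT G := rot_continuous_sigma_algebra M0.
have Gpre (f : plane R -> measurableTypeR R) : (forall c, G (f @^-1` `]c, +oo[)) ->
    forall A, measurable A -> G (f @^-1` A).
  move=> fc A mA; have : <<s @RGenOInfty.G R >> A.
    suff : (@RGenOInfty.G R).-sigma.-measurable A by [].
    by rewrite -RGenOInfty.measurableE.
  apply: (@smallest_sub _ _ _ [set A | G (f @^-1` A)]) => [|_ [x ->]]; last exact: fc.
  split => /=.
  - by rewrite preimage_set0.
  - by move=> B GB; rewrite setTD preimage_setC -setTD; exact: GC.
  - by move=> B GB; rewrite preimage_bigcup; exact: GU.
have G1 c : G (fst @^-1` `]c, +oo[).
  split; first by rewrite -[X in measurable X]setTI; exact: measurable_fst.
  have := @rot_continuous_halfplane R M c M0; congr (rot_continuous (cind (_ `&` _))).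
  by apply/seteqP; split => z; rewrite /= in_itv /= andbT.
have G2 c : G (snd @^-1` `]c, +oo[).
  split; first by rewrite -[X in measurable X]setTI; exact: measurable_snd.
  (* A quarter turn carries the half-planes in $x$ to those in $y$. *)
  have := rot_continuous_rot (- (pi / 2)) (@rot_continuous_halfplane R M c M0);
    congr rot_continuous.
  apply/funext => z; rewrite !cindI /cind indic_rot_disc; congr (_ * _).
  rewrite !indicE; congr ((_ %:R)%:C%C).
  rewrite (_ : (rot _ z \in _) = (z \in snd @^-1` `]c, +oo[))//.
  apply/idP/idP; rewrite !inE /= in_itv /= andbT /rot /= cosN sinN cos_pihalf
    sin_pihalf; lra.
have GS : sigma_algebra setT G by [].
suff : G E by case.
apply: (smallest_sub GS _ mE) => _ [|] [A mA <-]; rewrite setTI; exact: Gpre.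
Qed.

Lemma rot_continuous_sum (R : realType) (I : Type) (r : seq I) (F : I -> wavefun R) :
  (forall i, rot_continuous (F i)) -> rot_continuous (fun z => \sum_(i <- r) F i z).
Proof.
move=> cF; elim: r => [|i r IH].
  have := rot_continuousZ 0 (rot_continuous_disc (lexx (0 : R)));
    congr rot_continuous; apply/funext => z.
  by rewrite mul0r big_nil.
have := rot_continuousD (cF i) IH; congr rot_continuous; apply/funext => z.
by rewrite big_cons.
Qed.

Lemma rot_continuous_nnsfun (R : realType) (f : {nnsfun (plane R) >-> R}) (M : R) :
  0 <= M -> rot_continuous (fun z => (f z * \1_(disc M) z)%:C%C).
Proof.
move=> M0.
have : rot_continuous (fun z => \sum_(y <- finmap.enum_fset (fset_set (range f)))
    y%:C%C * cind (f @^-1` [set y] `&` disc M) z).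
  by apply: rot_continuous_sum => y; apply: rot_continuousZ; exact: rot_continuous_cind.
congr rot_continuous; apply/funext => z;
  rewrite [X in (X * _)%:C%C]fimfunE fsbig_finite//=.
rewrite mulr_suml rmorph_sum.
apply: eq_bigr => y _; rewrite cindI /cind; apply: complexP; rewrite !ReImE /=; ring.
Qed.

Lemma rot_continuous_nonneg (R : realType) (f : plane R -> R) :
  (forall z, 0 <= f z) -> square_integrable (fun z => (f z)%:C%C) ->
  rot_continuous (fun z => (f z)%:C%C).
Proof.
move=> f0 sf; have /sqiP[[mf _] _] := sf.
have mfE : measurable_fun [set: plane R] (EFin \o f) by exact/measurable_EFinP.
pose g k := nnsfun_approx measurableT mfE k.
(* Cutting the $k$-th simple function to the disc of radius $k$ makes it square-integrable without
   losing pointwise convergence. *)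
pose v k : wavefun R := fun z => (g k z * \1_(disc k%:R) z)%:C%C.
have cv k : rot_continuous (v k) by exact: rot_continuous_nnsfun.
have gf k z : g k z <= f z.
  by rewrite -lee_fin /g nnsfun_approxE; apply: le_approx => // w _; rewrite lee_fin.
have g0 k z : 0 <= g k z by exact: fun_ge0.
apply: rot_continuous_closed => // e e0.
have [] := @cvg_norm2 R (fun z => (f z)%:C%C) (fun z => (f z)%:C%C) v _ _ _ _ _ e e0.
- by split => //; exact: measurable_cst.
- by move=> k; have [/sqiP[]] := cv k.
- by [].
- move=> k z; rewrite /v -rmorphB !sqnorm_real /=.
  rewrite ler_pXn2r// ?nnegrE//; rewrite indicE; case: (_ \in _);
    by rewrite ?mulr1 ?mulr0 ?subr0 ?subr_ge0 ?gerBl.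
- move=> z.
  have [K zK] : exists K : nat, forall k, (K <= k)%N -> disc k%:R z.
    (* The successor makes $k$ positive, so that $|z|^2<k\le k^2$. *)
    exists (Num.bound (z.1 ^+ 2 + z.2 ^+ 2)).+1 => k Kk; rewrite /disc /=.
    have h0 : 0 <= z.1 ^+ 2 + z.2 ^+ 2 :> R by rewrite addr_ge0 ?sqr_ge0.
    apply/ltW/(lt_le_trans (archi_boundP h0)).
    apply: (@le_trans _ _ (k%:R : R)); first by rewrite ler_nat ltnW.
    by rewrite -natrX ler_nat; case: k Kk => // k _; rewrite expnS leq_pmulr// expn_gt0.
  have gz : g k z @[k --> \oo] --> f z.
    have := @cvg_nnsfun_approx _ _ _ _ measurableT _ mfE (fun w _ => f0 w) z I.
    by move=> /fine_cvgP[].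
  apply: (@cvg_trans _ (((f z - g k z) ^+ 2) @[k --> \oo])).
    apply: near_eq_cvg; exists K => // k /= Kk.
    by rewrite /v -rmorphB sqnorm_real /= indicE mem_set ?mulr1//; exact: zK.
  have : (f z - g k z) ^+ 2 @[k --> \oo] --> (f z - f z) ^+ 2.
    under eq_fun do rewrite expr2; rewrite expr2.
    by apply: cvgM; apply: cvgB => //; exact: cvg_cst.
  by rewrite subrr expr0n.
- by move=> k hk; exists (v k).
Qed.

Lemma max0_sub (R : realType) (x : R) : Num.max x 0 - Num.max (- x) 0 = x.
Proof. by case: (leP x 0) => hx; case: (leP (- x) 0); lra. Qed.

(** The positive and negative parts of the real and imaginary parts are dominated by [u], hence
    square-integrable. *)
Lemma strong_continuity (R : realType) (u : wavefun R) : square_integrable u ->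
  rot_continuous u.
Proof.
move=> su; have /sqiP[[mr mi] _] := su.
have real (f : plane R -> R) : measurable_fun setT f ->
    (forall z, f z ^+ 2 <= sqnorm (u z)) -> rot_continuous (fun z => (f z)%:C%C).
  move=> mf fu.
  have pos (h : plane R -> R) : measurable_fun setT h ->
      (forall z, h z ^+ 2 <= sqnorm (u z)) ->
        rot_continuous (fun z => (Num.max (h z) 0)%:C%C).
    move=> mh hu; apply: rot_continuous_nonneg => [z|];
      first by rewrite le_max lexx orbT.
    apply: (norm2_mono _ su _).1; first by split;
      [exact: measurable_maxr|exact: measurable_cst].
    move=> z; apply: le_trans (hu z); rewrite sqnorm_real.
    by case: (leP 0 (h z)) => // _; rewrite expr0n/= sqr_ge0.
  have cf := pos f mf fu.
  have cnf : rot_continuous (fun z => (Num.max (- f z) 0)%:C%C).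
    by apply: pos => [|z]; [exact: measurable_funN|rewrite sqrrN].
  have := rot_continuousB cf cnf; congr rot_continuous; apply/funext => z.
  rewrite -rmorphB /=; congr (_%:C%C).
  exact: max0_sub.
have := rot_continuousD (real _ mr _) (rot_continuousZ (Complex 0 1) (real _ mi _)).
rewrite (_ : (fun z => _) = u).
  apply=> z; rewrite /sqnorm; first by rewrite lerDl sqr_ge0.
  by rewrite lerDr sqr_ge0.
by apply/funext => z; apply: complexP; rewrite !ReImE /=; ring.
Qed.

(** * Integrals along orbits *)

Lemma translation_preserving (R : realType) (c : R) :
  measure_preserving (@lebesgue_measure R) (fun x => x + c).
Proof.
split=> [|A mA]; first exact: measurable_funD.
exact: lebesgue_measureD.
Qed.

Lemma Rintegral_translation (R : realType) (a b c : R) (f : R -> R) :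
  measurable_fun setT f ->
  \int[@lebesgue_measure R]_(x in `[(a + c)%R, (b + c)%R]) f x =
  \int[@lebesgue_measure R]_(x in `[a, b]) f (x + c).
Proof.
move=> mf; rewrite Rintegral_mkcond [RHS]Rintegral_mkcond; congr fine.
rewrite -(integral_preserving (translation_preserving c)) /=; last first.
  by apply/measurable_EFinP/measurable_restrict => //; exact: measurable_funTS.
apply: eq_integral => x _; rewrite /patch; congr (_%:E).
rewrite (_ : (x + c \in `[(a + c)%R, (b + c)%R]%classic) = (x \in `[a, b]%classic))//.
by apply/idP/idP; rewrite !inE /= !in_itv /= !lerD2r.
Qed.

Lemma cint_translation (R : realType) (a b c : R) (f : R -> R[i]) :
  cmeasurable (f : measurableTypeR R -> R[i]) ->
  cint (@lebesgue_measure R) `[(a + c)%R, (b + c)%R] f =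
  cint (@lebesgue_measure R) `[a, b] (fun x => f (x + c)).
Proof.
move=> [mr mi]; congr Complex; first exact: (Rintegral_translation _ _ _ mr).
exact: (Rintegral_translation _ _ _ mi).
Qed.

(** Tonelli applies to the positive and negative parts separately, so the integral is measurable in
    the parameter even where a section is not integrable and the value is a default. *)
Lemma measurable_Rintegral_G d1 d2 (T1 : measurableType d1) (T2 : measurableType d2)
    (R : realType) (m1 : {sigma_finite_measure set T1 -> \bar R})
    (D : set T1) (f : T1 * T2 -> R) : measurable D -> measurable_fun setT f ->
  measurable_fun setT (fun y => \int[m1]_(x in D) f (x, y)).
Proof.
move=> mD mf; pose g (z : T1 * T2) := (f z * \1_D z.1)%:E.
have mg : measurable_fun setT g.
  apply/measurable_EFinP/measurable_funM => //.
  by apply: (measurableT_comp _ measurable_fst); exact: measurable_indic.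
rewrite (_ : (fun y => _) = fun y => fine (\int[m1]_x g (x, y))%E).
  apply: (measurableT_comp (f := fine)) => //.
  under eq_fun do rewrite integralE.
  apply: emeasurable_funB.
    have := measurable_fun_fubini_tonelli_G (m1 := m1) _
      (measurable_funepos mg) (funepos_ge0 g).
    rewrite /fubini_G; congr (measurable_fun _); apply/funext => y.
    by apply: eq_integral => x _; rewrite !funeposE.
  have := measurable_fun_fubini_tonelli_G (m1 := m1) _
    (measurable_funeneg mg) (funeneg_ge0 g).
  rewrite /fubini_G; congr (measurable_fun _); apply/funext => y.
  by apply: eq_integral => x _; rewrite !funenegE.
apply/funext => y; rewrite Rintegral_mkcond; congr fine.
apply: eq_integral => x _; rewrite /g /patch indicE; case: (_ \in _) => /=.
  by rewrite mulr1.
by rewrite mulr0.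
Qed.

Lemma cmeasurable_cint d1 d2 (T1 : measurableType d1) (T2 : measurableType d2)
    (R : realType) (m1 : {sigma_finite_measure set T1 -> \bar R})
    (D : set T1) (f : T1 * T2 -> R[i]) : measurable D -> cmeasurable f ->
  cmeasurable (fun y => cint m1 D (fun x => f (x, y))).
Proof.
move=> mD [mr mi]; split; first exact: (measurable_Rintegral_G m1 mD mr).
exact: (measurable_Rintegral_G m1 mD mi).
Qed.

Lemma integrable_cst_fin d (T : measurableType d) (R : realType)
    (mu : {measure set T -> \bar R}) (D : set T) (s c : R) :
  measurable D -> mu D = s%:E -> mu.-integrable D (EFin \o (fun=> c)).
Proof.
move=> mD muD; apply/integrableP; split; first exact/measurable_EFinP.
rewrite (eq_integral (cst (`|c|%:E : \bar R)))// integral_cst//.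
by rewrite muD -EFinM ltry.
Qed.

Lemma Rintegral_cst_fin d (T : measurableType d) (R : realType)
    (mu : {measure set T -> \bar R}) (D : set T) (s c : R) :
  measurable D -> mu D = s%:E -> \int[mu]_(x in D) c = c * s.
Proof. by move=> mD muD; rewrite Rintegral_cst// muD. Qed.

(** Cauchy-Schwarz against the constant 1, read off from the nonnegativity of $\int_D(f-m)^2$ with
    $m$ the mean of $f$. The right side is an extended real so that it also covers an infinite
    second moment. *)
Lemma Rintegral_sqr_le d (T : measurableType d) (R : realType)
    (mu : {measure set T -> \bar R}) (D : set T) (s : R) (f : T -> R) :
  measurable D -> 0 < s -> mu D = s%:E -> measurable_fun setT f ->
  (((\int[mu]_(x in D) f x) ^+ 2)%:E <=
   s%:E * \int[mu]_(x in D) ((f x) ^+ 2)%:E)%E.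
Proof.
move=> mD s0 muD mf.
have mfD : measurable_fun D f by exact: measurable_funTS.
have mf2 : measurable_fun D (fun x => f x ^+ 2) by exact: measurable_funX.
have f2ge0 : (0 <= \int[mu]_(x in D) ((f x) ^+ 2)%:E)%E.
  by apply: integral_ge0 => x _; rewrite lee_fin sqr_ge0.
have [f2fin|] := ltP (\int[mu]_(x in D) ((f x) ^+ 2)%:E)%E +oo%E; last first.
  by rewrite leye_eq => /eqP ->; rewrite mulry gtr0_sg// mul1e leey.
have i2 : mu.-integrable D (EFin \o (fun x => f x ^+ 2)).
  apply/integrableP; split; first exact/measurable_EFinP.
  apply: le_lt_trans f2fin; rewrite le_eqVlt; apply/orP; left; apply/eqP.
  by apply: eq_integral => x _; rewrite /= ger0_norm ?sqr_ge0.
have ic (c : R) := integrable_cst_fin c mD muD.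
have i1 : mu.-integrable D (EFin \o f).
  apply: (le_integrable mD _ _ (integrableD mD (ic 1) i2)).
    exact/measurable_EFinP.
  move=> x _ /=; rewrite lee_fin [leRHS]ger0_norm ?addr_ge0 ?sqr_ge0//.
  rewrite ler_norml; have := sqr_ge0 (f x - 1); have := sqr_ge0 (f x + 1).
  rewrite sqrrB sqrrD; have := sqr_ge0 (f x); lra.
set I1 := \int[mu]_(x in D) f x.
have E2 : (\int[mu]_(x in D) ((f x) ^+ 2)%:E)%E = (\int[mu]_(x in D) (f x ^+ 2))%:E.
  by rewrite /Rintegral fineK// ge0_fin_numE.
rewrite E2 -EFinM lee_fin; set I2 := \int[mu]_(x in D) (f x ^+ 2).
pose m := I1 / s.
have : 0 <= \int[mu]_(x in D) (f x ^+ 2 + (- (2 * m) * f x + m ^+ 2)).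
  apply: Rintegral_ge0 => x _.
  by rewrite (_ : _ + _ = (f x - m) ^+ 2) ?sqr_ge0//; ring.
have i3 : mu.-integrable D (EFin \o (fun x => - (2 * m) * f x)).
  exact: (integrableZl mD (- (2 * m)) i1).
rewrite RintegralD//; last exact: (integrableD mD i3 (ic (m ^+ 2))).
rewrite RintegralD// RintegralZl// Rintegral_cst//.
have -> : fine (mu D) = s by rewrite muD.
rewrite -/I1 -/I2 => h; rewrite -subr_ge0.
rewrite (_ : _ - _ = s * (I2 + (- (2 * m) * I1 + m ^+ 2 * s))).
  by rewrite mulr_ge0// ltW.
by rewrite /m; field; rewrite gt_eqF.
Qed.

Lemma sqnorm_cint_le d (T : measurableType d) (R : realType)
    (mu : {measure set T -> \bar R}) (D : set T) (s : R) (f : T -> R[i]) :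
  measurable D -> 0 < s -> mu D = s%:E -> cmeasurable f ->
  ((sqnorm (cint mu D f))%:E <=
   s%:E * \int[mu]_(x in D) (sqnorm (f x))%:E)%E.
Proof.
move=> mD s0 muD [mr mi]; rewrite {1}/sqnorm /= EFinD.
apply: (le_trans (leeD (Rintegral_sqr_le mD s0 muD mr) (Rintegral_sqr_le mD s0
  muD mi))).
rewrite -ge0_muleDr; last 2 first.
- by apply: integral_ge0 => x _; rewrite lee_fin sqr_ge0.
- by apply: integral_ge0 => x _; rewrite lee_fin sqr_ge0.
rewrite -ge0_integralD//; last 4 first.
- by move=> x _; rewrite lee_fin sqr_ge0.
- by apply/measurable_EFinP/measurable_funX; exact: measurable_funTS.
- by move=> x _; rewrite lee_fin sqr_ge0.
- by apply/measurable_EFinP/measurable_funX; exact: measurable_funTS.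
Qed.

Lemma tonelli_sqnorm d (T : measurableType d) (R : realType)
    (mu : {sigma_finite_measure set T -> \bar R}) (D : set T)
    (h : T * plane R -> R[i]) : measurable D -> cmeasurable h ->
  (\int[plane_measure R]_z \int[mu]_(x in D) (sqnorm (h (x, z)))%:E =
   \int[mu]_(x in D) enorm2 (fun z => h (x, z)))%E.
Proof.
move=> mD mh; pose g (z : T * plane R) := (sqnorm (h z) * \1_D z.1)%:E.
have mg : measurable_fun setT g.
  apply/measurable_EFinP/measurable_funM; first exact: cmeasurable_sqnorm.
  by apply: (measurableT_comp _ measurable_fst); exact: measurable_indic.
have g0 z : (0 <= g z)%E.
  by rewrite lee_fin mulr_ge0 ?sqnorm_ge0// indicE.
transitivity (\int[plane_measure R]_z \int[mu]_x g (x, z))%E.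
  apply: eq_integral => z _; rewrite [LHS]integral_mkcond; apply: eq_integral => x _.
  by rewrite /g /patch indicE; case: (_ \in _) => /=; rewrite ?mulr1 ?mulr0.
have := fubini_tonelli (m1 := mu) (m2 := plane_measure R) g mg g0.
move=> E; transitivity (\int[mu]_x \int[plane_measure R]_z g (x, z))%E.
  exact: esym E.
rewrite [RHS]integral_mkcond; apply: eq_integral => x _.
rewrite /patch; case: ifPn => xD.
  by apply: eq_integral => z _; rewrite /g /= indicE xD mulr1.
rewrite (eq_integral (cst 0%E)) ?integral0// => z _.
by rewrite /g /= indicE (negbTE xD) mulr0.
Qed.

Lemma measurable_partial_sqnorm d (T : measurableType d) (R : realType)
    (mu : {sigma_finite_measure set T -> \bar R}) (D : set T)
    (h : T * plane R -> R[i]) : measurable D -> cmeasurable h ->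
  measurable_fun setT (fun z => \int[mu]_(x in D) (sqnorm (h (x, z)))%:E)%E.
Proof.
move=> mD mh.
have mg : measurable_fun setT (fun z : T * plane R =>
    (sqnorm (h z) * \1_D z.1)%:E).
  apply/measurable_EFinP/measurable_funM; first exact: cmeasurable_sqnorm.
  by apply: (measurableT_comp _ measurable_fst); exact: measurable_indic.
have g0 z : (0 <= (sqnorm (h z) * \1_D z.1)%:E)%E.
  by rewrite lee_fin mulr_ge0 ?sqnorm_ge0// indicE.
have := measurable_fun_fubini_tonelli_G (m1 := mu) _ mg g0.
congr (measurable_fun _).
apply/funext => z; rewrite /fubini_G [RHS]integral_mkcond.
apply: eq_integral => x _.
by rewrite /patch indicE; case: (_ \in _) => /=; rewrite ?mulr1 ?mulr0.
Qed.

Lemma integral_enorm2_le d (T : measurableType d) (R : realType)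
    (mu : {sigma_finite_measure set T -> \bar R}) (D : set T) (s B : R)
    (h : T * plane R -> R[i]) :
  measurable D -> mu D = s%:E -> cmeasurable h ->
  (forall t, D t -> (enorm2 (fun z => h (t, z)) <= B%:E)%E) ->
  (\int[mu]_(x in D) enorm2 (fun z => h (x, z)) <= (s * B)%:E)%E.
Proof.
move=> mD muD mh hB.
apply: (@le_trans _ _ (\int[mu]_(x in D) cst B%:E x)%E); last first.
  rewrite integral_cst// EFinM muleC le_eqVlt; apply/orP; left; apply/eqP.
  by congr (_ * _)%E; exact: muD.
apply: ge0_le_integral => //.
- by move=> x _; exact: enorm2_ge0.
- have := measurable_fun_fubini_tonelli_F (m2 := plane_measure R)
    (fun z => (sqnorm (h z))%:E) _ _.
  rewrite /fubini_F => H; apply: measurable_funTS; apply: H.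
    exact/measurable_EFinP/cmeasurable_sqnorm.
  by move=> z; rewrite lee_fin sqnorm_ge0.
Qed.

(** Cauchy-Schwarz in time at each point, then Tonelli; each of the two steps contributes one factor
    [s]. *)
Lemma enorm2_cint_le d (T : measurableType d) (R : realType)
    (mu : {sigma_finite_measure set T -> \bar R}) (D : set T) (s B : R)
    (h : T * plane R -> R[i]) :
  measurable D -> 0 < s -> mu D = s%:E -> cmeasurable h ->
  (forall t, D t -> (enorm2 (fun z => h (t, z)) <= B%:E)%E) ->
  (enorm2 (fun z => cint mu D (fun t => h (t, z))) <= (s ^+ 2 * B)%:E)%E.
Proof.
move=> mD s0 muD mh hB.
have mhz z : cmeasurable (fun t : T => h (t, z)).
  by apply: (cmeasurable_comp mh); exact: measurable_fun_pair.
have mhx x : cmeasurable (fun z : plane R => h (x, z)).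
  by apply: (cmeasurable_comp mh); exact: measurable_fun_pair.
have mF := measurable_partial_sqnorm mu mD mh.
apply: (@le_trans _ _ (\int[plane_measure R]_z (s%:E *
    \int[mu]_(x in D) (sqnorm (h (x, z)))%:E))%E).
  apply: ge0_le_integral => //.
  - by move=> z _; rewrite lee_fin sqnorm_ge0.
  - by apply/measurable_EFinP/cmeasurable_sqnorm; exact: (cmeasurable_cint mu mD mh).
  - by apply: emeasurable_funM => //; exact: measurable_cst.
  - by move=> z _; exact: (sqnorm_cint_le mD s0 muD (mhz z)).
rewrite ge0_integralZl//; last 2 first.
- by move=> z _; apply: integral_ge0 => x _; rewrite lee_fin sqnorm_ge0.
- by rewrite lee_fin ltW.
rewrite tonelli_sqnorm// expr2 -mulrA EFinM lee_pmul2l// ?lte_fin//.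
exact: integral_enorm2_le.
Qed.

(** By Tonelli the second moment in time is finite for almost every $z$, and on a set of finite
    measure this implies integrability. *)
Lemma ae_cintegrable d (T : measurableType d) (R : realType)
    (mu : {sigma_finite_measure set T -> \bar R}) (D : set T) (s B : R)
    (h : T * plane R -> R[i]) :
  measurable D -> 0 < s -> mu D = s%:E -> cmeasurable h ->
  (forall t, D t -> (enorm2 (fun z => h (t, z)) <= B%:E)%E) ->
  {ae plane_measure R, forall z, cintegrable mu D (fun t => h (t, z))}.
Proof.
move=> mD s0 muD mh hB.
have mhz z : cmeasurable (fun t : T => h (t, z)).
  by apply: (cmeasurable_comp mh); exact: measurable_fun_pair.
pose F z := (\int[mu]_(x in D) (sqnorm (h (x, z)))%:E)%E.
have F0 z : (0 <= F z)%E by apply: integral_ge0 => x _; rewrite lee_fin sqnorm_ge0.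
have mF : measurable_fun setT F.
  exact: measurable_partial_sqnorm.
have iF : (plane_measure R).-integrable setT F.
  apply/integrableP; split=> //.
  rewrite (eq_integral F); last by move=> z _; rewrite gee0_abs.
  rewrite tonelli_sqnorm//.
  exact: le_lt_trans (integral_enorm2_le mD muD mh hB) (ltry _).
apply: (ae_plane_mono _ (integrable_ae measurableT iF)) => z /(_ I) Fz.
have isq : mu.-integrable D (fun x => (sqnorm (h (x, z)))%:E).
  apply/integrableP; split.
    by apply/measurable_EFinP; apply: measurable_funTS; exact: cmeasurable_sqnorm.
  rewrite (eq_integral (fun x => (sqnorm (h (x, z)))%:E)); last first.
    by move=> x _; rewrite gee0_abs// lee_fin sqnorm_ge0.
  by have := Fz; rewrite ge0_fin_numE.
have ic := integrable_cst_fin 1 mD muD.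
have bound (f : T -> R) : measurable_fun setT f ->
    (forall x, f x ^+ 2 <= sqnorm (h (x, z))) -> mu.-integrable D (EFin \o f).
  move=> mf fh; apply: (le_integrable mD _ _ (integrableD mD ic isq)).
    by apply/measurable_EFinP; exact: measurable_funTS.
  move=> x _ /=; rewrite lee_fin [leRHS]ger0_norm;
    last exact: addr_ge0 ler01 (sqnorm_ge0 _).
  rewrite ler_norml; have := sqr_ge0 (f x - 1); have := sqr_ge0 (f x + 1).
  rewrite sqrrB sqrrD; have := sqr_ge0 (f x); have := fh x; lra.
have [mr mi] := mhz z.
split; apply: bound => // x.
  by rewrite /sqnorm lerDl sqr_ge0.
by rewrite /sqnorm lerDr sqr_ge0.
Qed.

(** * The exponential weight *)

Definition cexp (R : realType) (k : R[i]) (t : R) : R[i] :=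
  (expR (complex.Re k * t))%:C%C * expi (complex.Im k * t).

Lemma expiD (R : realType) (s t : R) : expi (s + t) = expi s * expi t.
Proof. by apply: complexP; rewrite !ReImE /= ?cosD ?sinD; ring. Qed.

Lemma expi0 (R : realType) : expi 0 = 1 :> R[i].
Proof. by rewrite /expi cos0 sin0. Qed.

Lemma cexpD (R : realType) (k : R[i]) (s t : R) :
  cexp k (s + t) = cexp k s * cexp k t.
Proof.
by rewrite /cexp !mulrDr expRD expiD rmorphM; ring.
Qed.

Lemma cexp0 (R : realType) (k : R[i]) : cexp k 0 = 1.
Proof. by rewrite /cexp !mulr0 expR0 expi0 mulr1. Qed.

Lemma sqnorm_cexp (R : realType) (k : R[i]) (t : R) :
  sqnorm (cexp k t) = expR (complex.Re k * t) ^+ 2.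
Proof. by rewrite /cexp sqnormM sqnorm_real sqnorm_expi mulr1. Qed.

Lemma sqnorm_cexp_le (R : realType) (k : R[i]) (s t : R) : `|t| <= s ->
  sqnorm (cexp k t) <= expR (`|complex.Re k| * s) ^+ 2.
Proof.
move=> ts; rewrite sqnorm_cexp ler_pXn2r ?nnegrE ?expR_ge0// ler_expR.
by apply: le_trans (ler_norm _) _; rewrite normrM ler_wpM2l.
Qed.

Lemma cexp_conj (R : realType) (k : R[i]) (t : R) : cexp k t * cexp k (- t) = 1.
Proof. by rewrite -cexpD subrr cexp0. Qed.

Lemma measurable_cos (R : realType) : measurable_fun setT (@cos R).
Proof. by apply: continuous_measurable_fun; exact: continuous_cos. Qed.

Lemma measurable_sin (R : realType) : measurable_fun setT (@sin R).
Proof. by apply: continuous_measurable_fun; exact: continuous_sin. Qed.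

Lemma cmeasurable_cexp (R : realType) (k : R[i]) :
  cmeasurable (cexp k : measurableTypeR R -> R[i]).
Proof.
have mM (c : R) : measurable_fun setT (fun t : measurableTypeR R => c * t).
  by apply: measurable_funM => //; exact: measurable_cst.
apply: cmeasurableM; split => /=.
- by apply: measurableT_comp => //; exact: measurable_expR.
- exact: measurable_cst.
- exact: (measurableT_comp (@measurable_cos R) (mM _)).
- exact: (measurableT_comp (@measurable_sin R) (mM _)).
Qed.

Lemma measurable_rot2 (R : realType) :
  measurable_fun setT (fun p : measurableTypeR R * plane R =>
    rot p.1 p.2 : plane R).
Proof.
have m1 : measurable_fun setT (fun p : measurableTypeR R * plane R => p.2.1).
  exact: (measurableT_comp measurable_fst measurable_snd).
have m2 : measurable_fun setT (fun p : measurableTypeR R * plane R => p.2.2).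
  exact: (measurableT_comp measurable_snd measurable_snd).
have mc : measurable_fun setT (fun p : measurableTypeR R * plane R => cos p.1).
  exact: (measurableT_comp (@measurable_cos R) measurable_fst).
have ms : measurable_fun setT (fun p : measurableTypeR R * plane R => sin p.1).
  exact: (measurableT_comp (@measurable_sin R) measurable_fst).
apply/measurable_fun_pairP; split => /=.
  by apply: measurable_funB; exact: measurable_funM.
by apply: measurable_funD; exact: measurable_funM.
Qed.

Lemma is_derive_quotient (R : realType) (f : R -> R) (l e : R) :
  is_derive (0 : R) 1 f l -> 0 < e ->
  exists2 d : R, 0 < d & forall t, t != 0 -> `|t| < d ->
    `|t^-1 * (f t - f 0) - l| < e.
Proof.
move=> [dv <-] e0; have /(_ _ _ e0) := (@cvgrPdist_lt _ _ _ _ _ _ _).1 dv.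
rewrite /dnbhs /within /= => /nbhs_ballP[d /= d0 hd].
exists d => // t t0 td; have := hd t; rewrite /ball /= sub0r normrN => /(_ td t0).
by rewrite /shift /GRing.scale /= mulr1 addr0 distrC.
Qed.

Lemma cexp_derive (R : realType) (k : R[i]) e : 0 < e ->
  exists2 d : R, 0 < d & forall t, t != 0 -> `|t| < d ->
    sqnorm ((t^-1)%:C%C * (cexp k t - 1) - k) < e.
Proof.
move=> e0; case: k => b g.
have dr : is_derive (0 : R) 1 (fun t : R => expR (b * t) * cos (g * t)) b.
  apply: is_derive_eq.
  rewrite !mulr0 expR0 cos0 sin0 /GRing.scale /=; ring.
have di : is_derive (0 : R) 1 (fun t : R => expR (b * t) * sin (g * t)) g.
  apply: is_derive_eq.
  rewrite !mulr0 expR0 cos0 sin0 /GRing.scale /=; ring.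
(* The cap 1 gives $u^2\le|u|$, so each squared component stays below $e/2$. *)
pose e' := Num.min 1 (e / 2).
have e'0 : 0 < e' by rewrite lt_min ltr01 divr_gt0.
have [d d0 hd] := is_derive_quotient dr e'0.
have [d' d'0 hd'] := is_derive_quotient di e'0.
exists (Num.min d d'); first by rewrite lt_min d0.
move=> t t0; rewrite lt_min => /andP[/(hd t t0) + /(hd' t t0)].
rewrite !mulr0 expR0 cos0 sin0 !mul1r.
set x := _ - b; set y := _ - g => hx hy.
have small (u : R) : `|u| < e' -> u ^+ 2 < e / 2.
  rewrite lt_min => /andP[u1 u2]; rewrite -real_normK ?num_real// expr2.
  by apply: le_lt_trans u2; rewrite ler_piMl// ltW.
rewrite (_ : sqnorm _ = x ^+ 2 + y ^+ 2).
  by rewrite [ltRHS]splitr ltrD// small.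
by rewrite /sqnorm /x /y !ReImE /= oppr0; ring.
Qed.

Lemma cexp_continuous0 (R : realType) (k : R[i]) e : 0 < e ->
  exists2 d : R, 0 < d & forall t, `|t| < d -> sqnorm (cexp k t - 1) < e.
Proof.
move=> e0; have [d d0 hd] := cexp_derive k ltr01.
(* [C] bounds the squared modulus of $(e^{kt}-1)/t$, which is $k$ plus an error of squared modulus
   below 1. *)
pose C := 2 * sqnorm k + 2; have C0 : 0 < C by rewrite ltr_wpDl ?mulr_ge0 ?sqnorm_ge0.
pose d' := Num.min 1 (e / C).
have d'0 : 0 < d' by rewrite lt_min ltr01 divr_gt0.
exists (Num.min d d'); first by rewrite lt_min d0.
move=> t; have [->|t0] := eqVneq t 0; first by rewrite cexp0 subrr sqnorm0.
rewrite !lt_min => /andP[/(hd t t0) h /andP[t1 te]].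
have -> : cexp k t - 1 = t%:C%C * (k + ((t^-1)%:C%C * (cexp k t - 1) - k)).
  rewrite (addrC k) subrK mulrA -rmorphM mulfV//; exact/esym/mul1r.
rewrite sqnormM sqnorm_real -real_normK ?num_real//.
rewrite ltr_pdivlMr// in te; apply: le_lt_trans te.
rewrite expr2 -mulrA ler_wpM2l//.
apply: le_trans (ler_piMl _ (ltW t1)) _; first exact: sqnorm_ge0.
apply: le_trans (sqnormD _ _) _; rewrite /C lerD2l; lra.
Qed.

(* the integral over [0, s] of e^{k tau} U(tau) g, taken pointwise; its value at
   z is junk when the orbit of z is not integrable, a null event *)
Definition orbint (R : realType) (k : R[i]) (s : R) (g : wavefun R) : wavefun R :=
  fun z => cint mu1 `[0%R, s] (fun tau => cexp k tau * g (rot tau z)).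

Lemma cmeasurable_orbit (R : realType) (k : R[i]) (g : wavefun R) :
  cmeasurable (g : plane R -> R[i]) ->
  cmeasurable (fun p : measurableTypeR R * plane R => cexp k p.1 * g (rot p.1 p.2)).
Proof.
move=> mg; apply: cmeasurableM.
  exact: (cmeasurable_comp (@cmeasurable_cexp R k) measurable_fst).
exact: (cmeasurable_comp mg (@measurable_rot2 R)).
Qed.

Lemma measure_itv0 (R : realType) (s : R) : 0 < s ->
  mu1 (`[0%R, s]%classic : set (measurableTypeR R)) = s%:E.
Proof. by move=> s0; rewrite lebesgue_measure_itv /= lte_fin s0 oppr0 adde0. Qed.

Lemma measurable_itv0 (R : realType) (s : R) :
  measurable (`[0%R, s]%classic : set (measurableTypeR R)).
Proof. exact: measurable_itv. Qed.

Lemma enorm2_orbit_le (R : realType) (k : R[i]) (s t : R) (g : wavefun R) :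
  square_integrable g -> `|t| <= s ->
  (enorm2 (fun z => (cexp k t * g (rot t z))%R) <=
   (expR (`|complex.Re k| * s) ^+ 2 * norm2 g)%:E)%E.
Proof.
move=> sg ts; have sgt := sqi_rot t sg; rewrite -norm2E; last exact: sqiZ.
by rewrite lee_fin norm2Z// norm2_rot// ler_wpM2r ?norm2_ge0// sqnorm_cexp_le.
Qed.

Lemma orbint_sqi (R : realType) (k : R[i]) (s : R) (g : wavefun R) : 0 < s ->
  square_integrable g ->
  square_integrable (orbint k s g) /\
  norm2 (orbint k s g) <= s ^+ 2 * (expR (`|complex.Re k| * s) ^+ 2 * norm2 g).
Proof.
move=> s0 sg; have /sqiP[mg _] := sg; have mh := cmeasurable_orbit k mg.
have mK : cmeasurable (orbint k s g : plane R -> R[i]).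
  exact: (cmeasurable_cint mu1 (measurable_itv0 s) mh).
have le : (enorm2 (orbint k s g) <=
    (s ^+ 2 * (expR (`|complex.Re k| * s) ^+ 2 * norm2 g))%:E)%E.
  apply: (enorm2_cint_le (measurable_itv0 s) s0 (measure_itv0 s0) mh) => t /=.
  rewrite in_itv /= => /andP[t0 ts]; apply: enorm2_orbit_le => //.
  by rewrite ger0_norm.
have sK : square_integrable (orbint k s g).
  by apply/sqiP; split => //; exact: le_lt_trans le (ltry _).
by split=> //; rewrite -lee_fin norm2E.
Qed.

Lemma ae_orbit_cintegrable (R : realType) (k : R[i]) (s : R) (g : wavefun R) :
  0 < s -> square_integrable g ->
  {ae plane_measure R, forall z, cintegrable (@lebesgue_measure R)
    (`[0%R, s]%classic : set (measurableTypeR R)) (fun tau => cexp k tau * g (rot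
      tau z))}.
Proof.
move=> s0 sg; have /sqiP[mg _] := sg; have mh := cmeasurable_orbit k mg.
apply: (ae_cintegrable (measurable_itv0 s) s0 (measure_itv0 s0) mh) => t /=.
rewrite in_itv /= => /andP[t0 ts]; apply: (@enorm2_orbit_le R k s t g sg).
by rewrite ger0_norm.
Qed.

Lemma cint_itv_split (R : realType) (s t : R) (f : R -> R[i]) :
  0 <= s -> 0 <= t ->
  cintegrable (@lebesgue_measure R) `[0, s + t] f ->
  cint (@lebesgue_measure R) `[0, s + t] f =
  cint (@lebesgue_measure R) `[0, s] f + cint (@lebesgue_measure R) `[s, s + t] f.
Proof.
move=> s0 t0.
have aux (g : R -> R) : (@lebesgue_measure R).-integrable `[0, s + t] (EFin \o g) ->
    \int[@lebesgue_measure R]_(x in `[0, (s + t)%R]) g x =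
    \int[@lebesgue_measure R]_(x in `[0, s]) g x +
    \int[@lebesgue_measure R]_(x in `[s, (s + t)%R]) g x.
  move=> ig.
  have i2 : (@lebesgue_measure R).-integrable `]s, s + t] (EFin \o g).
    apply: (integrableS _ _ _ ig) => //.
    by move=> x; rewrite /= !in_itv /= => /andP[sx ->]; rewrite (le_trans s0 (ltW sx)).
  rewrite -(Rintegral_itv_obnd_cbnd i2).
  rewrite -(@Rintegral_itvB _ g (BLeft 0) (BRight (s + t)) s ig).
  - by rewrite subrKC.
  - by rewrite bnd_simp.
  - by rewrite bnd_simp lerDl.
by move=> [fr fi]; apply: complexP; rewrite !ReImE /=; exact: aux.
Qed.

(** The piece over $[s,s+t]$, shifted back to $[0,t]$, is an orbit integral started from the rotated
    point. Both pieces must be integrable, hence the restriction to almost every $z$. *)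
Lemma orbintD (R : realType) (k : R[i]) (s t : R) (g : wavefun R) :
  0 < s -> 0 < t -> square_integrable g ->
  eq_ae (orbint k (s + t) g)
    (fun z => orbint k s g z + cexp k s * orbint k t g (rot s z)).
Proof.
move=> s0 t0 sg; have /sqiP[mg _] := sg; have mh := cmeasurable_orbit k mg.
have st0 : 0 < s + t by rewrite addr_gt0.
apply: (ae_plane_mono2 _ (ae_orbit_cintegrable k st0 sg)
  (ae_rot s (ae_orbit_cintegrable k t0 sg))) => z h1 h2.
rewrite {1}/orbint cint_itv_split ?ltW//; congr (_ + _).
rewrite /orbint -(cintZ (measurable_itv0 t) _ h2).
have -> : `[s, s + t] = `[(0 + s)%R, (t + s)%R] by rewrite add0r addrC.
rewrite cint_translation; last first.
  exact: (cmeasurable_comp mh (pair2_measurable z)).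
apply: eq_cint => x _; rewrite rotD (addrC x) cexpD -mulrA.
by rewrite -[in RHS]rotD -rotD addrC.
Qed.

Lemma cint_cst (R : realType) (t : R) (c : R[i]) : 0 < t ->
  cintegrable (@lebesgue_measure R) (`[0%R, t]%classic : set (measurableTypeR R))
    (fun=> c) /\
  cint (@lebesgue_measure R) (`[0%R, t]%classic : set (measurableTypeR R))
    (fun=> c) = t%:C%C * c.
Proof.
move=> t0; have mD := measurable_itv0 t; have muD := measure_itv0 t0.
have ic (r : R) := integrable_cst_fin r mD muD.
split; first by split; exact: ic.
by apply: complexP; rewrite !ReImE /= (Rintegral_cst_fin _ mD muD); ring.
Qed.

Lemma norm2_orbit_small (R : realType) (k : R[i]) (g : wavefun R) e :
  square_integrable g -> 0 < e -> exists2 d : R, 0 < d & forall t, `|t| < d ->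
    norm2 (fun z => cexp k t * g (rot t z) - g z) < e.
Proof.
(* [W] bounds $|e^{kt}|^2$ for $|t|\le1$, which is why the radius below is capped by 1. *)
move=> sg e0; pose W := expR (`|complex.Re k| * 1) ^+ 2.
have W0 : 0 < W by rewrite exprn_gt0 ?expR_gt0.
have [_ cg] := strong_continuity sg.
have [d d0 hd] : exists2 d : R, 0 < d & forall t, `|t| < d ->
    norm2 (fun z => g (rot t z) - g z) < e / (4 * W).
  by apply: cg; rewrite divr_gt0// mulr_gt0.
have N1 : 0 < 4 * (norm2 g + 1) by rewrite mulr_gt0// ltr_wpDl ?norm2_ge0.
have [d' d'0 hd'] := cexp_continuous0 k (divr_gt0 e0 N1).
exists (Num.min 1 (Num.min d d')); first by rewrite !lt_min ltr01 d0.
move=> t; rewrite !lt_min => /andP[/ltW t1 /andP[/hd h /hd' h']].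
have -> : (fun z => cexp k t * g (rot t z) - g z) =
  (fun z => cexp k t * (g (rot t z) - g z) + (cexp k t - 1) * g z).
  by apply/funext => z; ring.
have sd : square_integrable (fun z => g (rot t z) - g z).
  by apply: sqiB => //; exact: sqi_rot.
apply: le_lt_trans (norm2D_le (sqiZ _ sd) (sqiZ _ sg)) _; rewrite !norm2Z//.
have a1 : sqnorm (cexp k t) * norm2 (fun z => g (rot t z) - g z) < W * (e / (4 * W)).
  apply: (@le_lt_trans _ _ (W * norm2 (fun z => g (rot t z) - g z))).
    by rewrite ler_wpM2r ?norm2_ge0// sqnorm_cexp_le.
  by rewrite ltr_pM2l.
have a2 : sqnorm (cexp k t - 1) * norm2 g <= e / (4 * (norm2 g + 1)) * (norm2 g + 1).
  by apply: ler_pM; rewrite ?sqnorm_ge0 ?norm2_ge0 ?(ltW h')// lerDl.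
have E1 : W * (e / (4 * W)) = e / 4 by field; rewrite gt_eqF.
have E2 : e / (4 * (norm2 g + 1)) * (norm2 g + 1) = e / 4.
  by field; have := norm2_ge0 g; lra.
rewrite E1 in a1; rewrite E2 in a2; lra.
Qed.

(** The $t^2$ in the bound for an integral over $[0,t]$ cancels the square of the averaging factor
    $1/t$, so strong continuity of the orbit passes to its averages. *)
Lemma orbint_average (R : realType) (k : R[i]) (g : wavefun R) e :
  square_integrable g -> 0 < e -> exists2 d : R, 0 < d & forall t, 0 < t < d ->
    norm2 (fun z => (t^-1)%:C%C * orbint k t g z - g z) < e.
Proof.
move=> sg e0; have e2 : 0 < e / 2 by rewrite divr_gt0.
have /sqiP[mg _] := sg; have mh := cmeasurable_orbit k mg.
have [d d0 hd] := norm2_orbit_small k sg e2; exists d => // t /andP[t0 td].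
have [sK _] := orbint_sqi k t0 sg.
have mh' : cmeasurable (fun p : measurableTypeR R * plane R =>
    cexp k p.1 * g (rot p.1 p.2) - g p.2).
  by apply: cmeasurableD => //; apply: cmeasurableN;
    exact: (cmeasurable_comp mg measurable_snd).
pose F : wavefun R := fun z => cint mu1 (`[0%R, t]%classic : set (measurableTypeR R))
  (fun tau => cexp k tau * g (rot tau z) - g z).
have mF : cmeasurable (F : plane R -> R[i]).
  exact: (cmeasurable_cint (@lebesgue_measure R) (measurable_itv0 t) mh').
have Fle : (enorm2 F <= (t ^+ 2 * (e / 2))%:E)%E.
  apply: (enorm2_cint_le (measurable_itv0 t) t0 (measure_itv0 t0) mh') => x /=.
  rewrite in_itv /= => /andP[x0 xt]; rewrite -norm2E; last first.
    by apply: sqiB => //; apply/sqiZ/sqi_rot.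
  by rewrite lee_fin ltW// hd// ger0_norm// (le_lt_trans xt).
have sF : square_integrable F.
  by apply/sqiP; split => //; exact: le_lt_trans Fle (ltry _).
have E : eq_ae (fun z => (t^-1)%:C%C * orbint k t g z - g z) (fun z =>
  (t^-1)%:C%C * F z).
  apply: (ae_plane_mono _ (ae_orbit_cintegrable k t0 sg)) => z hz.
  have [cz1 cz2] := cint_cst (- g z) t0.
  rewrite /F (cintD (measurable_itv0 t) hz cz1) cz2 mulrDr mulrA -rmorphM.
  by rewrite mulVf ?gt_eqF// rmorph1 mul1r.
have sT : square_integrable (fun z => (t^-1)%:C%C * orbint k t g z - g z).
  by apply: sqiB => //; exact: sqiZ.
have /sqiP[mT _] := sT.
rewrite (eq_ae_norm2 mT (cmeasurableZ _ mF) E) norm2Z// sqnorm_real.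
rewrite -norm2E// lee_fin in Fle.
apply: (@le_lt_trans _ _ (t^-1 ^+ 2 * (t ^+ 2 * (e / 2)))).
  by rewrite ler_wpM2l ?sqr_ge0.
by rewrite exprVn mulKf ?expf_neq0 ?gt_eqF//; lra.
Qed.

(** Splitting the integral over $[0,s+t]$ at $s$ and at $t$ gives
    $e^{kt}U(t)K_s-K_s=e^{ks}U(s)K_t-K_t$ for $t>0$. The derivative thus reduces to the averages
    $K_t/t\to g$. *)
Lemma orbint_right_derivative (R : realType) (k : R[i]) (s : R) (g : wavefun R) e :
  0 < s -> square_integrable g -> 0 < e ->
  exists2 d : R, 0 < d & forall t, 0 < t < d ->
    norm2 (fun z => (t^-1)%:C%C * (cexp k t * orbint k s g (rot t z) - orbint k s g z)
                - (cexp k s * g (rot s z) - g z)) < e.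
Proof.
move=> s0 sg e0.
(* The error is $e^{ks}U(s)m-m$, where [m] is the averaging error; its squared norm costs this
   factor. *)
have S0 : 0 < 2 * sqnorm (cexp k s) + 2 by rewrite ltr_wpDl ?mulr_ge0 ?sqnorm_ge0.
have [d d0 hd] := orbint_average k sg (divr_gt0 e0 S0).
exists d => // t td; have /andP[t0 _] := td; have {hd td}hd := hd t td.
pose m : wavefun R := fun z => (t^-1)%:C%C * orbint k t g z - g z.
have [sKs _] := orbint_sqi k s0 sg; have [sKt _] := orbint_sqi k t0 sg.
have sm : square_integrable m by apply: sqiB => //; exact: sqiZ.
have E : eq_ae
  (fun z => (t^-1)%:C%C * (cexp k t * orbint k s g (rot t z) - orbint k s g z)
     - (cexp k s * g (rot s z) - g z))
  (fun z => cexp k s * m (rot s z) - m z).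
  apply: (ae_plane_mono2 _ (orbintD k s0 t0 sg) (orbintD k t0 s0 sg)) => z h1 h2.
  have : orbint k s g z + cexp k s * orbint k t g (rot s z) =
    orbint k t g z + cexp k t * orbint k s g (rot t z) by rewrite -h1 -h2 addrC.
  move=> /eqP; rewrite addrC -subr_eq => /eqP h.
  rewrite /m (_ : cexp k t * orbint k s g (rot t z) - orbint k s g z =
      cexp k s * orbint k t g (rot s z) - orbint k t g z).
    by ring.
  by rewrite -h; ring.
have sL : square_integrable
  (fun z => (t^-1)%:C%C * (cexp k t * orbint k s g (rot t z) - orbint k s g z)
     - (cexp k s * g (rot s z) - g z)).
  apply: sqiB; first by apply/sqiZ/sqiB => //; apply/sqiZ/sqi_rot.
  by apply: sqiB => //; apply/sqiZ/sqi_rot.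
have sR : square_integrable (fun z => cexp k s * m (rot s z) - m z).
  by apply: sqiB => //; apply/sqiZ/sqi_rot.
have /sqiP[mL _] := sL; have /sqiP[mR _] := sR.
rewrite (eq_ae_norm2 mL mR E).
apply: le_lt_trans (norm2B_le (sqiZ _ (sqi_rot s sm)) sm) _.
rewrite norm2Z; last exact: sqi_rot.
rewrite norm2_rot// mulrA -mulrDl mulrC -ltr_pdivlMr//.
Qed.

(* A right derivative is a derivative, because rotations are unitary. *)
Lemma right_derivative_two_sided (R : realType) (u u' : wavefun R) :
  square_integrable u -> square_integrable u' ->
  (forall e, 0 < e -> exists2 d : R, 0 < d & forall t, 0 < t < d ->
     norm2 (fun z => quot t u z - u' z) < e) ->
  forall e, 0 < e -> exists2 d : R, 0 < d & forall t, t != 0 -> `|t| < d ->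
     norm2 (fun z => quot t u z - u' z) < e.
Proof.
move=> su su' h e e0; have e4 : 0 < e / 4 by rewrite divr_gt0.
have [d d0 hd] := h _ e4; have [d' d'0 hd'] := (strong_continuity su').2 _ e4.
exists (Num.min d d'); first by rewrite lt_min d0.
move=> t t0; rewrite lt_min => /andP[td td'].
have sq r : square_integrable (quot r u) by apply/sqiZ/sqiB => //; exact: sqi_rot.
case: (ltrP 0 t) => [tgt0|tle0].
  have := hd t; rewrite tgt0 -{1}(gtr0_norm tgt0) td => /(_ isT); lra.
have tlt0 : t < 0 by rewrite lt_neqAle t0.
(* For negative $t$ the quotient at $t$ is $U(t)$ applied to the quotient at $-t$; strong continuity
   at [u'] absorbs the extra rotation. *)
have E : (fun z => quot t u z - u' z) = (fun z =>
    (quot (- t) u (rot t z) - u' (rot t z)) + (u' (rot t z) - u' z)).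
  apply/funext => z; rewrite addrA subrK; congr (_ - _); rewrite /quot.
  by rewrite rotK invrN rmorphN mulNr -mulrN opprB.
have sm : square_integrable (fun z => quot (- t) u z - u' z) by exact: sqiB.
rewrite E; apply: le_lt_trans (norm2D_le (sqi_rot t sm) (sqiB (sqi_rot t su') su')) _.
rewrite (norm2_rot t sm); have := hd (- t); have := hd' t td'.
rewrite oppr_gt0 tlt0 -{1}(ltr0_norm tlt0) td => h1 /(_ isT) h2; lra.
Qed.

(** What has been differentiated so far is $e^{kt}U(t)K$. Multiplying by $e^{-kt}$ produces the term
    $-kK$, as in the product rule. *)
Lemma orbint_derivative (R : realType) (k : R[i]) (s : R) (g : wavefun R) :
  0 < s -> square_integrable g ->
  forall e, 0 < e -> exists2 d : R, 0 < d & forall t, t != 0 -> `|t| < d ->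
    norm2 (fun z => quot t (orbint k s g) z -
       ((cexp k s * g (rot s z) - g z) - k * orbint k s g z)) < e.
Proof.
move=> s0 sg; set K := orbint k s g.
have [sK _] := orbint_sqi k s0 sg.
pose v : wavefun R := fun z => cexp k s * g (rot s z) - g z.
have sv : square_integrable v by apply: sqiB => //; apply/sqiZ/sqi_rot.
have su' : square_integrable (fun z => v z - k * K z) by apply: sqiB => //; exact: sqiZ.
apply: right_derivative_two_sided => // e e0.
pose W := expR (`|complex.Re k| * 1) ^+ 2.
have W0 : 0 < W by rewrite exprn_gt0 ?expR_gt0.
(* The nested splitting weights the three errors by 2, 4 and 4, so the shares $e/8$, $e/16$ and
   $e/16$ sum to $3e/4$. *)
have e1 : 0 < e / (8 * W) by rewrite divr_gt0// mulr_gt0.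
have e2 : 0 < e / (16 * (norm2 v + 1)).
  by rewrite divr_gt0// mulr_gt0// ltr_wpDl ?norm2_ge0.
have e3 : 0 < e / (16 * (norm2 K + 1)).
  by rewrite divr_gt0// mulr_gt0// ltr_wpDl ?norm2_ge0.
have [d1 d10 h1] := orbint_right_derivative k s0 sg e1.
have [d2 d20 h2] := cexp_continuous0 k e2.
have [d3 d30 h3] := cexp_derive k e3.
exists (Num.min 1 (Num.min d1 (Num.min d2 d3))).
  by rewrite !lt_min ltr01 d10 d20.
move=> t; rewrite !lt_min => /andP[t0 /andP[t1 /andP[td1 /andP[td2 td3]]]].
have nt : `|- t| = t by rewrite normrN gtr0_norm.
have {}h1 : norm2 _ < _ := h1 t (introT andP (conj t0 td1)).
have {}h2 : sqnorm (cexp k (- t) - 1) < e / (16 * (norm2 v + 1)) by apply: h2;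
  rewrite nt.
have {}h3 : sqnorm (((- t)^-1)%:C%C * (cexp k (- t) - 1) - k) < e / (16 * (norm2
  K + 1)).
  by apply: h3; rewrite ?nt// oppr_eq0 gt_eqF.
set c := cexp k (- t) in h2 h3.
pose A : wavefun R := fun z =>
  (t^-1)%:C%C * (cexp k t * K (rot t z) - K z) - v z.
have sA : square_integrable A.
  by apply: sqiB => //; apply/sqiZ/sqiB => //; apply/sqiZ/sqi_rot.
have E : (fun z => quot t K z - (v z - k * K z)) = (fun z =>
    c * A z + ((c - 1) * v z +
       (- (((- t)^-1)%:C%C * (c - 1) - k)) * K z)).
  apply/funext => z; rewrite /A /quot.
  set X := cexp k t * K (rot t z).
  have -> : K (rot t z) = c * X by rewrite /X mulrA [c * _]mulrC cexp_conj mul1r.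
  by rewrite invrN rmorphN; ring.
rewrite E; apply: le_lt_trans (norm2D_le (sqiZ _ sA) (sqiD (sqiZ _ sv) (sqiZ _ sK))) _.
have := norm2D_le (sqiZ (c - 1) sv) (sqiZ (- (((- t)^-1)%:C%C * (c - 1) - k)) sK).
rewrite !norm2Z// sqnormN => h.
have cW : sqnorm c <= W by apply: sqnorm_cexp_le; rewrite nt ltW.
have a1 : sqnorm c * norm2 A <= W * (e / (8 * W)).
  by apply: ler_pM; rewrite ?sqnorm_ge0 ?norm2_ge0 ?(ltW h1).
have a2 : sqnorm (c - 1) * norm2 v <= e / (16 * (norm2 v + 1)) * (norm2 v + 1).
  by apply: ler_pM; rewrite ?sqnorm_ge0 ?norm2_ge0 ?(ltW h2)// lerDl.
have a3 : sqnorm (((- t)^-1)%:C%C * (c - 1) - k) * norm2 K <=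
    e / (16 * (norm2 K + 1)) * (norm2 K + 1).
  by apply: ler_pM; rewrite ?sqnorm_ge0 ?norm2_ge0 ?(ltW h3)// lerDl.
have E1 : W * (e / (8 * W)) = e / 8 by field; rewrite gt_eqF.
have E2 : e / (16 * (norm2 v + 1)) * (norm2 v + 1) = e / 16.
  by field; have := norm2_ge0 v; lra.
have E3 : e / (16 * (norm2 K + 1)) * (norm2 K + 1) = e / 16.
  by field; have := norm2_ge0 K; lra.
rewrite E1 in a1; rewrite E2 in a2; rewrite E3 in a3; lra.
Qed.

(** The sector relation for [g] may fail on a null set that orbits meet. Its defect [q] has norm
    zero, and the norm bound for orbit integrals shows that the integrated defect vanishes almost
    everywhere. *)
Lemma orbint_sector (R : realType) n a (k : R[i]) (s : R) (g : wavefun R) :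
  0 < s -> sector n a g -> sector n a (orbint k s g).
Proof.
move=> s0 [sg eg]; have [sK _] := orbint_sqi k s0 sg; split=> //.
set T := 2 * pi / n%:R in eg *; set w := expi _ in eg *.
pose q : wavefun R := fun z => g (rot T z) - w * g z.
have sT : square_integrable (fun z => g (rot T z)) by exact: sqi_rot.
have sq : square_integrable q by apply: sqiB => //; exact: sqiZ.
have q0 : norm2 q = 0.
  have /sqiP[mq _] := sq.
  rewrite (eq_ae_norm2 mq (@cmeasurable_cst _ _ R 0)); last first.
    by apply: (ae_plane_mono _ eg) => z h; rewrite /q h subrr.
  by rewrite norm2_cst0.
have [sKq] := orbint_sqi k s0 sq; rewrite q0 !mulr0 => Kq0.
have {}Kq0 : eq_ae (orbint k s q) (fun=> 0).
  by apply: norm2_eq0 => //; apply/eqP; rewrite eq_le norm2_ge0 Kq0.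
have I1 := ae_orbit_cintegrable k s0 sg; have I2 := ae_orbit_cintegrable k s0 sT.
apply: (ae_plane_mono2 _ I1 (ae_plane_mono2 (fun z h1 h2 => conj h1 h2) I2 Kq0)).
move=> z h1 [h2 h3]; apply/eqP; rewrite -subr_eq0 -h3; apply/eqP.
have mD := measurable_itv0 s.
rewrite /orbint -(cintZ mD _ h1) -(cintN mD (cintegrableZ mD _ h1)).
rewrite -cintD//; last first.
  by apply: cintegrableN => //; exact: cintegrableZ.
  by apply: (eq_cintegrable mD _ h2) => x _; rewrite -!rotD addrC.
apply: eq_cint => x _; rewrite /q -!rotD (addrC x); ring.
Qed.

Lemma orbint_generator (R : realType) n a (k : R[i]) (s : R) (g : wavefun R) :
  (0 < n)%N -> 0 < s -> sector n a g ->
  rotation_generator n a (orbint k s g)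
    (fun z => (cexp k s * g (rot s z) - g z) - k * orbint k s g z).
Proof.
move=> n0 s0 sg; have sK := orbint_sector k s0 sg.
apply/rotation_generatorP => //; split=> //.
  apply: sectorB; last exact: sectorZ.
  by apply: sectorB => //; apply/sectorZ/sector_rot.
by apply: orbint_derivative => //; case: sg.
Qed.

(** * Resolvent, self-adjointness and spectrum *)

Lemma rotation_generatorZ (R : realType) n a c (u u' : wavefun R) : (0 < n)%N ->
  rotation_generator n a u u' ->
  rotation_generator n a (fun z => c * u z) (fun z => c * u' z).
Proof.
move=> n0 /(rotation_generatorP _ _ _ n0)[su su' h].
apply/rotation_generatorP => //; split; [exact: sectorZ|exact: sectorZ|].
move=> e e0; have c1 : 0 < sqnorm c + 1 by rewrite ltr_wpDl// sqnorm_ge0.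
have [d d0 {}h] := h _ (divr_gt0 e0 c1); exists d => // t t0 td.
have {}h := h t t0 td.
have sm : square_integrable (fun z => quot t u z - u' z).
  by apply: sqiB; [exact: sector_sqi (sector_quot t su)|case: su'].
rewrite (_ : (fun z => _) = (fun z => c * (quot t u z - u' z))); last first.
  by apply/funext => z; rewrite /quot; ring.
rewrite norm2Z//; rewrite ltr_pdivlMr// in h; apply: le_lt_trans h.
by rewrite mulrC ler_wpM2l ?norm2_ge0// lerDl.
Qed.

Lemma eq_ae_rotation_generator (R : realType) n a (u u' v v' : wavefun R) :
  (0 < n)%N -> rotation_generator n a u u' -> sector n a v -> sector n a v' ->
  eq_ae u v -> eq_ae u' v' -> rotation_generator n a v v'.
Proof.
move=> n0 /(rotation_generatorP _ _ _ n0)[su su' h] sv sv' uv uv'.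
apply/rotation_generatorP => //; split=> // e e0.
have [d d0 {}h] := h _ e0; exists d => // t t0 td; have {}h := h t t0 td.
have sq w w' : sector n a w -> sector n a w' ->
    cmeasurable (fun z : plane R => quot t w z - w' z).
  move=> sw sw'; have : square_integrable (fun z : plane R => quot t w z - w' z).
    by apply: sqiB; [exact: sector_sqi (sector_quot t sw)|case: sw'].
  by move=> /sqiP[].
rewrite -(eq_ae_norm2 (sq _ _ su su') (sq _ _ sv sv'))//.
apply: (ae_plane_mono2 _ uv (ae_plane_mono2 (fun z h1 h2 => conj h1 h2) uv'
  (ae_rot t uv))).
by move=> z e1 [e2 e3]; rewrite /quot e1 e2 e3.
Qed.

Lemma eq_ae_ipr (R : realType) (u v v' : wavefun R) : square_integrable u ->
  square_integrable v -> square_integrable v' -> eq_ae v v' ->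
  ip u v = ip u v'.
Proof.
move=> /sqiP[mu _] /sqiP[mv _] /sqiP[mv' _] vv'.
have [mr mi] := cmeasurableM (cmeasurableC mu) mv.
have [mr' mi'] := cmeasurableM (cmeasurableC mu) mv'.
congr Complex; congr fine; apply: ae_eq_integral => //; do ?exact/measurable_EFinP.
  by apply: filterS vv' => z /= -> _.
by apply: filterS vv' => z /= -> _.
Qed.

Lemma Lz_sector (R : realType) (hbar : R) n a (u u' : wavefun R) :
  Lz hbar n a u u' -> sector n a u /\ sector n a u'.
Proof. by move=> [d [su sd _] ->]; split=> //; exact: sectorZ. Qed.

Lemma Lz_symmetric (R : realType) (hbar : R) n a (u u' v v' : wavefun R) :
  (0 < n)%N -> Lz hbar n a u u' -> Lz hbar n a v v' -> ip u v' = ip u' v.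
Proof.
move=> n0 [du gu ->] [dv gv ->].
have [[su _] [sdu _] _] := gu; have [[sv _] [sdv _] _] := gv.
rewrite ipZr// ipZl// (generator_skew n0 gu gv).
by apply: complexP; rewrite !ReImE /=; ring.
Qed.

Lemma eq_ae_Lz (R : realType) (hbar : R) n a (u u' v v' : wavefun R) :
  hbar != 0 -> (0 < n)%N -> Lz hbar n a u u' -> sector n a v -> sector n a v' ->
  eq_ae u v -> eq_ae u' v' -> Lz hbar n a v v'.
Proof.
move=> h0 n0 [d gu ->] sv sv' uv uv'; set c := - Complex 0 hbar in uv' *.
have c0 : c != 0 by rewrite oppr_eq0 eq_complex /= (negbTE h0) andbF.
exists (fun z => c^-1 * v' z); last by apply/funext => z; rewrite mulVKf.
apply: (eq_ae_rotation_generator n0 gu) => //; first exact: sectorZ.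
by apply: (ae_plane_mono _ uv') => z <-; rewrite mulKf.
Qed.

(** * Periods of the phase *)

Lemma expiN (R : realType) (t : R) : expi (- t) = (expi t)^*%C.
Proof. by rewrite /expi cosN sinN. Qed.

Lemma expi_2piM (R : realType) (k : int) : expi (2 * pi * k%:~R) = 1 :> R[i].
Proof.
have nat_case (j : nat) : expi (2 * pi * j%:R) = 1 :> R[i].
  elim: j => [|j IH]; first by rewrite mulr0 expi0.
  rewrite (_ : 2 * pi * _ = 2 * pi * j%:R + 2 * pi); last first.
    by rewrite -[j.+1]addn1 natrD; ring.
  rewrite expiD IH mul1r /expi mulr_natl.
  by rewrite cos2pi -[X in sin X]add0r sinD2pi sin0.
case: k => k; first exact: nat_case.
rewrite NegzE mulrNz mulrN expiN nat_case.
by apply: complexP; rewrite !ReImE /= ?oppr0.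
Qed.

(** The floor reduces $t$ to $r\in[0,2\pi)$. Cosine is injective on $[0,\pi]$, and the reflection
    $2\pi-r$ excludes the remaining angles. *)
Lemma expi_eq1 (R : realType) (t : R) :
  expi t = 1 <-> exists k : int, t = 2 * pi * k%:~R.
Proof.
split=> [t1|[k ->]]; last exact: expi_2piM.
have p0 : 0 < 2 * pi :> R by rewrite mulr_gt0// pi_gt0.
pose k := Num.floor (t / (2 * pi)); exists k.
pose r := t - 2 * pi * k%:~R.
have er : expi r = 1.
  by rewrite /r expiD t1 mul1r -mulrN -intrN expi_2piM.
have [r0 r2] : 0 <= r /\ r < 2 * pi.
  have := Num.Theory.floor_itv (t / (2 * pi)); rewrite -/k => /andP[].
  rewrite ler_pdivlMr// ltr_pdivrMr// intrD mulrDl mul1r => h1 h2.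
  by rewrite /r; split; lra.
have [rc rs] : cos r = 1 /\ sin r = 0 by case: er.
suff r00 : r = 0 by apply/eqP; rewrite -subr_eq0; exact/eqP.
have cinj (x : R) : 0 <= x <= pi -> cos x = 1 -> x = 0.
  move=> xpi cx; apply: cos_inj; rewrite ?in_itv//= ?lexx ?pi_ge0//.
  by rewrite cos0.
case: (lerP r pi) => rp; first by apply: cinj; rewrite ?r0.
have : 2 * pi - r = 0.
  apply: cinj; first by apply/andP; split; lra.
  rewrite (_ : 2 * pi - r = - r + pi *+ 2); last by rewrite mulr2n; ring.
  by rewrite cosD2pi cosN.
lra.
Qed.

Lemma expi_inj (R : realType) (s t : R) :
  expi s = expi t <-> exists k : int, s - t = 2 * pi * k%:~R.
Proof.
rewrite -expi_eq1 expiD expiN.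
have tt : expi t * (expi t)^*%C = 1 by rewrite -expiN -expiD subrr expi0.
split=> [->//|h]; rewrite -[LHS]mulr1 -tt mulrCA h mulr1//.
Qed.

Definition Lz_level (R : realType) (hbar : R) (n a : nat) : set R[i] :=
  [set lam : R[i] | exists l : int, lam = (hbar * (a%:R + n%:R * l%:~R))%:C%C].

(* k = lam / (i hbar), so that lam = i hbar k *)
Definition rate (R : realType) (hbar : R) (lam : R[i]) : R[i] :=
  Complex (complex.Im lam / hbar) (- complex.Re lam / hbar).

Lemma rateE (R : realType) (hbar : R) (lam : R[i]) : hbar != 0 ->
  Complex 0 hbar * rate hbar lam = lam.
Proof.
by move=> h0; apply: complexP; rewrite !ReImE /=; field.
Qed.

(** The modulus of the factor forces $\lambda$ to be real; its phase then places $\lambda$ on the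
    lattice. *)
Lemma period_factor_eq1 (R : realType) (hbar : R) (n a : nat) (lam : R[i]) :
  0 < hbar -> (0 < n)%N ->
  cexp (rate hbar lam) (2 * pi / n%:R) * expi (2 * pi * a%:R / n%:R) = 1 ->
  Lz_level hbar n a lam.
Proof.
move=> h0 n0 e1; have nn : 0 < n%:R :> R by rewrite ltr0n.
have p0 : 0 < pi :> R by exact: pi_gt0.
have T0 : 0 < 2 * pi / n%:R :> R by rewrite divr_gt0// mulr_gt0.
have := congr1 (@sqnorm R) e1; rewrite sqnormM sqnorm_expi mulr1 sqnorm1 sqnorm_cexp /=.
move=> /eqP; rewrite sqrf_eq1 => /orP[|]; last first.
  by move=> /eqP h; have := expR_gt0 (complex.Im lam / hbar * (2 * pi / n%:R)); lra.
rewrite -[X in _ == X]expR0 => /eqP/expR_inj/eqP.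
rewrite mulf_eq0 (gt_eqF T0) orbF mulf_eq0 invr_eq0 (gt_eqF h0) orbF => /eqP im0.
move: e1; rewrite /cexp /= im0 !mul0r expR0 mul1r -expiD => /expi_eq1[k hk].
(* The sign reverses because [rate] contains $-\mathrm{Re}\,\lambda$. *)
exists (- k); apply: complexP => //=.
have solve (p m A x K : R) : p != 0 -> m != 0 ->
    - x / hbar * (2 * p / m) + 2 * p * A / m = 2 * p * K ->
    x = hbar * (A + m * - K).
  move=> p1 m1 e; have -> : x = hbar * (A - m / (2 * p) *
      (- x / hbar * (2 * p / m) + 2 * p * A / m)).
    by field; rewrite m1 p1 gt_eqF.
  by rewrite e; field.
by rewrite mulrNz; apply: (solve pi); rewrite ?gt_eqF.
Qed.

Lemma Lz_resolvent (R : realType) (hbar : R) (n a : nat) (lam : R[i]) :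
  0 < hbar -> (0 < n)%N -> ~ Lz_level hbar n a lam ->
  exists2 C : R, 0 <= C & forall eta, sector n a eta ->
    exists psi chi, [/\ Lz hbar n a psi chi,
      eq_ae (fun z => chi z - lam * psi z) eta & norm2 psi <= C * norm2 eta].
Proof.
move=> h0 n0 nl; set T : R := 2 * pi / n%:R; set k := rate hbar lam.
have T0 : 0 < T by rewrite divr_gt0 ?ltr0n// mulr_gt0// pi_gt0.
set w : R[i] := expi (2 * pi * a%:R / n%:R).
have c0 : cexp k T * w - 1 != 0.
  by apply/eqP => /eqP; rewrite subr_eq0 => /eqP /period_factor_eq1 h; apply: nl;
    exact: h.
set c := _ - 1 in c0.
have ih0 : Complex 0 hbar != 0 by rewrite eq_complex /= (gt_eqF h0) andbF.
(* [b] compensates both the factor $-i\hbar$ in $L_z-\lambda=-i\hbar(A+k)$ and the period factor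
   [c]. *)
pose b := (- Complex 0 hbar * c)^-1.
have bE : - Complex 0 hbar * c * b = 1.
  by rewrite /b mulfV// mulf_neq0// oppr_eq0.
exists (T ^+ 2 * (expR (`|complex.Re k| * T) ^+ 2 * sqnorm b)).
  apply: mulr_ge0; first exact: sqr_ge0.
  by apply: mulr_ge0; [exact: sqr_ge0|exact: sqnorm_ge0].
move=> eta se; have sbe := sectorZ b se; have [sqe ee] := se.
have [sq1 sq2] := orbint_sqi k T0 (sector_sqi sbe).
exists (orbint k T (fun z => b * eta z)); eexists; split.
- exists (fun z => (cexp k T * (b * eta (rot T z)) - b * eta z) -
     k * orbint k T (fun z => b * eta z) z); last by [].
  exact: (orbint_generator k n0 T0 sbe).
- apply: (ae_plane_mono _ ee) => z ez; rewrite ez -/w.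
  set X := orbint _ _ _ _.
  transitivity ((- Complex 0 hbar * c * b) * eta z + (Complex 0 hbar * k - lam) * X).
    by rewrite /c; ring.
  by rewrite bE (rateE _ (lt0r_neq0 h0)) subrr mul0r addr0 mul1r.
- apply: (le_trans sq2); rewrite norm2Z// le_eqVlt; apply/orP; left; apply/eqP.
  by ring.
Qed.

Lemma conj_Lz_level (R : realType) (hbar : R) (n a : nat) (lam : R[i]) :
  Lz_level hbar n a lam^*%C -> Lz_level hbar n a lam.
Proof.
move=> [l h]; exists l; apply: complexP.
  by rewrite -h ReC.
by have := congr1 (@complex.Im R) h; rewrite ImC /= => /eqP; rewrite oppr_eq0 => /eqP.
Qed.

(** If $(L_z-\bar\lambda)\varphi=\psi$, symmetry gives
    $|\psi|^2=\langle(L_z-\lambda)\psi,\varphi\rangle$, and $\varphi$ is bounded in terms of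
    $\psi$. *)
Lemma Lz_resolvent_bound (R : realType) (hbar : R) (n a : nat) (lam : R[i]) :
  0 < hbar -> (0 < n)%N -> ~ Lz_level hbar n a lam ->
  exists2 C : R, 0 <= C & forall psi chi, Lz hbar n a psi chi ->
    norm2 psi <= C * norm2 (fun z => chi z - lam * psi z).
Proof.
move=> h0 n0 nl.
have [C C0 hC] : exists2 C : R, 0 <= C & forall eta, sector n a eta ->
    exists psi chi, [/\ Lz hbar n a psi chi,
      eq_ae (fun z => chi z - lam^*%C * psi z) eta & norm2 psi <= C * norm2 eta].
  by apply: Lz_resolvent => // /conj_Lz_level.
exists (4 * (C + 1)); first by rewrite mulr_ge0// addr_ge0.
move=> psi chi L; have [sp sc] := Lz_sector L.
have [phi [xi [L' e h]]] := hC psi sp; have [sf sx] := Lz_sector L'.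
have sp' := sector_sqi sp; have sc' := sector_sqi sc.
have sf' := sector_sqi sf; have sx' := sector_sqi sx.
(* With this weight the term in [phi] is at most half of [norm2 psi] and is absorbed on the left,
   which doubles the constant to $4(C+1)$. *)
have D0 : 0 < 2 * (C + 1) by rewrite mulr_gt0// ltr_wpDl.
have E : ip psi psi = ip (fun z => chi z - lam * psi z) phi.
  rewrite -(eq_ae_ipr sp' _ sp' e); last by apply: sqiB => //; exact: sqiZ.
  rewrite ipBr//; last exact: sqiZ.
  rewrite ipBl//; last exact: sqiZ.
  by rewrite ipZr// ipZl// (Lz_symmetric n0 L L').
have sE : square_integrable (fun z => chi z - lam * psi z).
  by apply: sqiB => //; exact: sqiZ.
have := Re_ip_le D0 sE sf'; rewrite -E ip_self ger0_norm ?norm2_ge0// => h1.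
have h2 : (2 * (C + 1))^-1 * norm2 phi <= norm2 psi / 2.
  rewrite mulrC ler_pdivrMr//; apply: (le_trans h).
  have := norm2_ge0 psi; nra.
by have h3 := le_trans h1 (lerD (lexx _) h2); lra.
Qed.

Lemma nonreal_Lz_level (R : realType) (hbar : R) (n a : nat) (y : R) :
  y != 0 -> ~ Lz_level hbar n a (Complex 0 y).
Proof. by move=> y0 [l [_ /eqP]]; rewrite (negbTE y0). Qed.

Lemma hnorm_lt (R : realType) n (u : wavefun R) e : (0 < n)%N -> 0 < e ->
  norm2 u < n%:R * e ^+ 2 -> hnorm n u < e.
Proof.
move=> n0 e0 h; rewrite hnormE -[ltRHS](gtr0_norm e0) -sqrtr_sqr ltr_sqrt ?exprn_gt0//.
by rewrite ltr_pdivrMl ?ltr0n.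
Qed.

(** Short-time averages of an orbit, which are orbit integrals with $k=0$, lie in the domain and
    converge to the starting vector. *)
Lemma Lz_densely_defined (R : realType) (hbar : R) n a : (0 < n)%N ->
  densely_defined n a (@Lz R hbar n a).
Proof.
move=> n0 psi sp e e0.
have e'0 : 0 < n%:R * e ^+ 2 by rewrite mulr_gt0 ?ltr0n ?exprn_gt0.
have [d d0 hd] := orbint_average 0 (sector_sqi sp) e'0.
have t0 : 0 < d / 2 by rewrite divr_gt0.
exists (fun z => ((d / 2)^-1)%:C%C * orbint 0 (d / 2) psi z); eexists; split.
  eexists; last by [].
  by apply: rotation_generatorZ => //; exact: orbint_generator.
apply: hnorm_lt => //.
rewrite -norm2N (_ : (fun z => _) =
    fun z => ((d / 2)^-1)%:C%C * orbint 0 (d / 2) psi z - psi z).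
  by apply: hd; rewrite t0 ltr_pdivrMr//; lra.
by apply/funext => z; rewrite opprB.
Qed.

Lemma Lz_self_adjoint (R : realType) (hbar : R) n a : 0 < hbar -> (0 < n)%N ->
  self_adjoint n a (@Lz R hbar n a).
Proof.
move=> h0 n0; split; first exact: Lz_densely_defined.
move=> psi chi; split=> [L|[sp sc adj]].
  have [sp sc] := Lz_sector L; split=> // phi eta L'.
  by rewrite !innerE (Lz_symmetric n0 L L').
have adj' phi eta : Lz hbar n a phi eta -> ip psi eta = ip chi phi.
  move=> /adj; rewrite !innerE => /mulfI; apply.
  by rewrite eq_complex /= eqxx andbT invr_eq0 pnatr_eq0 -lt0n.
pose lam : R[i] := Complex 0 1.
have nl : ~ Lz_level hbar n a lam by apply: nonreal_Lz_level; exact: oner_neq0.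
have nl' : ~ Lz_level hbar n a lam^*%C.
  by move=> /conj_Lz_level.
have seta : sector n a (fun z => chi z - lam * psi z).
  by apply: sectorB => //; exact: sectorZ.
(* [u] lies in the domain and satisfies $(L_z-i)u=\chi-i\psi$; it remains to show that $u=\psi$
   almost everywhere. *)
have [C _ /(_ _ seta)[u [u' [Lu eu _]]]] := Lz_resolvent h0 n0 nl.
have [su su'] := Lz_sector Lu.
have spu : sector n a (fun z => psi z - u z) by exact: sectorB.
have [C' _ /(_ _ spu)[v [v' [Lv ev _]]]] := Lz_resolvent h0 n0 nl'.
have [sv sv'] := Lz_sector Lv.
have sp1 := sector_sqi sp; have sc1 := sector_sqi sc; have su1 := sector_sqi su.
have su'1 := sector_sqi su'; have sv1 := sector_sqi sv; have sv'1 := sector_sqi sv'.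
have seta1 := sector_sqi seta; have spu1 := sector_sqi spu.
(* psi and u have the same pairing with the range of L - conj(lam), which is
   everything *)
have key : ip (fun z => psi z - u z) (fun z => psi z - u z) = 0.
  rewrite -[X in X = 0](eq_ae_ipr spu1 _ spu1 ev); last first.
    by apply: sqiB => //; exact: sqiZ.
  have X1 : ip psi (fun z => v' z - lam^*%C * v z) = ip (fun z => chi z - lam *
    psi z) v.
    rewrite ipBr ?ipZr ?ipBl ?ipZl ?(adj' _ _ Lv)//; exact: sqiZ.
  have X2 : ip u (fun z => v' z - lam^*%C * v z) = ip (fun z => u' z - lam * u z) v.
    rewrite ipBr ?ipZr ?ipBl ?ipZl ?(Lz_symmetric n0 Lu Lv)//; exact: sqiZ.
  rewrite ipBl//; last by apply: sqiB => //; exact: sqiZ.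
  rewrite X1 X2 (eq_ae_ipl _ seta1 sv1 eu) ?subrr//.
  by apply: sqiB => //; exact: sqiZ.
have N0 : norm2 (fun z => psi z - u z) = 0 by rewrite -ip_self key.
have pu : eq_ae u psi.
  apply: (ae_plane_mono _ (norm2_eq0 spu1 N0)) => z /eqP.
  by rewrite subr_eq0 => /eqP.
apply: (eq_ae_Lz (lt0r_neq0 h0) n0 Lu) => //.
apply: (ae_plane_mono2 _ eu pu) => z h1 h2.
by move: h1; rewrite h2 => /addIr.
Qed.

Lemma Lz_spectrum_sub (R : realType) (hbar : R) n a : 0 < hbar -> (0 < n)%N ->
  spectrum n a (@Lz R hbar n a) `<=` Lz_level hbar n a.
Proof.
(* The spectrum is a complement, so off the lattice the three resolvent properties are to be
   proved. *)
move=> h0 n0 lam; apply: contrapT => /not_implyP[+ nl]; apply.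
have [C C0 hC] := Lz_resolvent_bound h0 n0 nl.
split.
- move=> psi chi L e; have [sp sc] := Lz_sector L.
  apply: norm2_eq0; first by case: sp.
  have sE : square_integrable (fun z => chi z - lam * psi z).
    by apply: sqiB; [case: sc|apply: sqiZ; case: sp].
  have /sqiP[mE _] := sE.
  have E0 : norm2 (fun z => chi z - lam * psi z) = 0.
    rewrite (eq_ae_norm2 mE (@cmeasurable_cst _ _ R 0) e).
    by rewrite norm2_cst0.
  by apply/eqP; rewrite eq_le norm2_ge0 andbT; have := hC _ _ L; rewrite E0 mulr0.
- move=> eta se; have [C' _ /(_ _ se)[psi [chi [L e _]]]] := Lz_resolvent h0 n0 nl.
  by exists psi, chi.
- exists (Num.sqrt C) => psi chi L; rewrite !hnormE -sqrtrM//.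
  rewrite ler_wsqrtr// mulrCA ler_wpM2l ?invr_ge0//; exact: hC.
Qed.

Lemma point_spectrum_sub (R : realType) (hbar : R) n a :
  point_spectrum (@Lz R hbar n a) `<=` spectrum n a (Lz hbar n a).
Proof.
move=> lam [psi [p0 L]] [inj _ _]; apply: p0; apply: (inj _ _ L).
by apply: aeW => z; rewrite subrr.
Qed.

(** * Eigenfunctions and quantization *)

Definition zC (R : realType) (z : plane R) : R[i] := Complex z.1 z.2.

Lemma zC_rot (R : realType) t (z : plane R) : zC (rot t z) = expi t * zC z.
Proof. by apply: complexP; rewrite !ReImE /rot /=; ring. Qed.

Lemma sqnorm_zC (R : realType) (z : plane R) :
  sqnorm (zC z) = z.1 ^+ 2 + z.2 ^+ 2.
Proof. by []. Qed.

(* The m-th power on the unit circle; conjugation replaces inversion so that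
   nothing blows up at the origin. *)
Definition cpow (R : realType) (m : int) (w : R[i]) : R[i] :=
  match m with Posz j => w ^+ j | Negz j => w^*%C ^+ j.+1 end.

Lemma sqnormX (R : realType) (w : R[i]) j : sqnorm (w ^+ j) = sqnorm w ^+ j.
Proof.
elim: j => [|j IH]; first by rewrite !expr0 sqnorm1.
by rewrite !exprS sqnormM IH.
Qed.

Lemma sqnorm_cpow (R : realType) m (w : R[i]) :
  sqnorm (cpow m w) = sqnorm w ^+ `|m|%N.
Proof. by case: m => j; rewrite /cpow sqnormX// sqnormC. Qed.

Lemma conjcM (R : realType) (x y : R[i]) : (x * y)^*%C = x^*%C * y^*%C.
Proof. by apply: complexP; rewrite !ReImE; ring. Qed.

Lemma cpowM (R : realType) m (x y : R[i]) : cpow m (x * y) = cpow m x * cpow m y.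
Proof. by case: m => j; rewrite /cpow ?conjcM exprMn. Qed.

Lemma expiX (R : realType) (t : R) j : expi t ^+ j = expi (j%:R * t).
Proof.
elim: j => [|j IH]; first by rewrite expr0 mul0r expi0.
by rewrite exprS IH -expiD -[j.+1]add1n natrD mulrDl mul1r.
Qed.

Lemma cpow_expi (R : realType) m (t : R) : cpow m (expi t) = expi (m%:~R * t).
Proof.
case: m => j; rewrite /cpow; first exact: expiX.
by rewrite -expiN expiX NegzE mulrNz mulNr mulrN.
Qed.

Lemma cpow_real (R : realType) m (r : R) : cpow m r%:C%C = (r ^+ `|m|%N)%:C%C.
Proof.
have -> : cpow m r%:C%C = r%:C%C ^+ `|m|%N.
  by case: m => j //; rewrite /cpow /= oppr0.
by rewrite rmorphXn.
Qed.

Lemma cmeasurableX d (T : measurableType d) (R : realType) (f : T -> R[i]) j :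
  cmeasurable f -> cmeasurable (fun x => f x ^+ j).
Proof.
move=> mf; elim: j => [|j IH].
  by under [X in cmeasurable X]eq_fun do rewrite expr0; exact: cmeasurable_cst.
by under [X in cmeasurable X]eq_fun do rewrite exprS; exact: cmeasurableM.
Qed.

Lemma cmeasurable_cpow d (T : measurableType d) (R : realType) (f : T -> R[i]) m :
  cmeasurable f -> cmeasurable (fun x => cpow m (f x)).
Proof. by case: m => j mf; apply: cmeasurableX => //; exact: cmeasurableC. Qed.

(** Starting at radius 1 keeps the origin out, so powers of $z$ and of its conjugate do not vanish
    there; half-open bounds make distinct annuli disjoint. *)
Definition annulus (R : realType) (j : nat) : set (plane R) :=
  [set z | j.+1%:R <= z.1 ^+ 2 + z.2 ^+ 2 < j.+2%:R].
Arguments annulus : clear implicits.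

Lemma measurable_annulus (R : realType) j : measurable (annulus R j).
Proof.
rewrite (_ : annulus R j =
    (fun z : plane R => z.1 ^+ 2 + z.2 ^+ 2) @^-1` `[j.+1%:R, j.+2%:R[).
  by rewrite -[X in measurable X]setTI; exact: measurable_sqdist.
by apply/seteqP; split => z; rewrite /annulus /= in_itv.
Qed.

Lemma annulus_rot (R : realType) j t (z : plane R) :
  annulus R j (rot t z) <-> annulus R j z.
Proof. by rewrite /annulus /= rot_sq. Qed.

Lemma annulus_nonnull (R : realType) j : ~ eq_ae (cind (annulus R j)) (fun=> 0).
Proof.
move=> h; have mA := @measurable_annulus R j.
have : plane_measure R (annulus R j) = 0%E.
  rewrite -enorm2_cind// /enorm2; under eq_integral do rewrite sqnorm_cind.
  rewrite (ae_eq_integral (cst 0%E))//; first by rewrite integral0.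
    by apply/measurable_EFinP; exact: measurable_indic.
  by apply: filterS h => z /(congr1 (@complex.Re R)) /= -> _.
(* The rectangle $[x,y]\times[0,1/2]$ fits in the annulus, since $u^2\in[j+1,j+3/2]$ and
   $v^2\le1/4$; its area is positive. *)
pose x : R := Num.sqrt j.+1%:R; pose y : R := Num.sqrt (j.+1%:R + 2^-1).
have xy : x < y by rewrite ltr_sqrt ?ltrDl ?invr_gt0// addr_gt0 ?invr_gt0 ?ltr0n.
have sub : `[x, y] `*` `[0, 2^-1] `<=` annulus R j.
  move=> [u v] [] /=; rewrite !in_itv /= => /andP[u1 u2] /andP[v1 v2].
  rewrite /annulus /=.
  have x0 : 0 <= x by exact: sqrtr_ge0.
  have X2 : x ^+ 2 = j.+1%:R by rewrite sqr_sqrtr.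
  have Y2 : y ^+ 2 = j.+1%:R + 2^-1 by rewrite sqr_sqrtr// addr_ge0// invr_ge0.
  have J2 : j.+2%:R = j.+1%:R + 1 :> R by rewrite -addn1 natrD.
  have h1 : x ^+ 2 <= u ^+ 2 by rewrite ler_pXn2r ?nnegrE// (le_trans x0).
  have h2 : u ^+ 2 <= y ^+ 2 by rewrite ler_pXn2r ?nnegrE ?sqrtr_ge0// (le_trans x0).
  have h3 : v ^+ 2 <= 2^-1 ^+ 2 by rewrite ler_pXn2r ?nnegrE// invr_ge0.
  rewrite (_ : 2^-1 ^+ 2 = 4^-1) in h3; last by field.
  rewrite X2 in h1; rewrite Y2 in h2; rewrite J2; have := sqr_ge0 v.
  by move=> v0; apply/andP; split; lra.
move=> A0.
have : (plane_measure R (`[x, y] `*` `[0%R, 2^-1%R]) <=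
    plane_measure R (annulus R j))%E.
  by apply: le_measure; rewrite ?inE//; exact: measurableX.
rewrite A0 rect_measure ?(ltW xy) ?invr_ge0// subr0 lee_fin.
by apply/negP; rewrite -ltNge mulr_gt0 ?subr_gt0 ?invr_gt0.
Qed.

Definition mode (R : realType) (m : int) (j : nat) : wavefun R :=
  fun z => cind (annulus R j) z * cpow m (zC z).
Arguments mode : clear implicits.

Lemma cind_rot_annulus (R : realType) j t (z : plane R) :
  cind (annulus R j) (rot t z) = cind (annulus R j) z.
Proof.
rewrite /cind !indicE (_ : (rot t z \in annulus R j) = (z \in annulus R j))//.
by apply/idP/idP; rewrite !inE annulus_rot.
Qed.

Lemma mode_rot (R : realType) m j t (z : plane R) :
  mode R m j (rot t z) = expi (m%:~R * t) * mode R m j z.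
Proof. by rewrite /mode cind_rot_annulus zC_rot cpowM cpow_expi mulrCA. Qed.

Lemma mode_sqi (R : realType) m j : square_integrable (mode R m j).
Proof.
have mz : cmeasurable (@zC R : plane R -> R[i]).
  by split; [exact: measurable_fst|exact: measurable_snd].
have mm : cmeasurable (mode R m j : plane R -> R[i]).
  by apply: cmeasurableM; [exact: cmeasurable_cind (@measurable_annulus R
    j)|exact: cmeasurable_cpow].
pose C : R := j.+2%:R ^+ `|m|%N.
have C1 : 1 <= C by rewrite exprn_ege1// ler1n.
have sv : square_integrable (fun z => C%:C%C * cind (disc j.+2%:R) z).
  by apply/sqiZ/(@sqi_cind R j.+2%:R) => //; exact: measurable_disc.
apply: (norm2_mono mm sv _).1 => z; rewrite /mode !sqnormM !sqnorm_cind.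
have [zA|zA] := pselect (annulus R j z); last first.
  by rewrite [X in X * _]indicE memNset// mul0r mulr_ge0 ?sqnorm_ge0// indicE.
have zD : disc j.+2%:R z.
  have /andP[_ /ltW h] := zA; apply: (le_trans h).
  by rewrite -natrX ler_nat expnS leq_pmulr.
rewrite !indicE !mem_set// mul1r mulr1 sqnorm_real sqnorm_cpow sqnorm_zC.
apply: (@le_trans _ _ C); last by rewrite expr2 ler_peMr// (le_trans ler01).
apply: lerXn2r; rewrite ?nnegrE ?ler0n ?addr_ge0 ?sqr_ge0//.
by have /andP[_ /ltW] := zA.
Qed.

Lemma expi_period (R : realType) (n a : nat) (l : int) : (0 < n)%N ->
  expi ((a%:R + n%:R * l%:~R) * (2 * pi / n%:R)) =
  expi (2 * pi * a%:R / n%:R) :> R[i].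
Proof.
move=> n0; have nn : n%:R != 0 :> R by rewrite pnatr_eq0 -lt0n.
have -> : (a%:R + n%:R * l%:~R) * (2 * pi / n%:R) =
    2 * pi * a%:R / n%:R + 2 * pi * l%:~R :> R.
  by move: (pi : R) => p; field.
by rewrite expiD expi_2piM mulr1.
Qed.

Lemma mode_sector (R : realType) (n a : nat) (l : int) j : (0 < n)%N ->
  sector n a (mode R (a%:Z + n%:Z * l) j).
Proof.
move=> n0; split; first exact: mode_sqi.
apply: aeW => z; rewrite mode_rot; congr (_ * _).
by rewrite -(expi_period R a l n0) intrD intrM.
Qed.

Lemma mode_angular (R : realType) m j :
  angular_mode m%:~R
    (fun r => if j.+1%:R <= r ^+ 2 < j.+2%:R then (r ^+ `|m|%N)%:C%C else 0)
    (mode R m j).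
Proof.
move=> r phi r0 _; rewrite /mode.
have -> : zC ((r * cos phi, r * sin phi) : plane R) = r%:C%C * expi phi.
  by apply: complexP; rewrite !ReImE /=; ring.
rewrite cpowM cpow_expi cpow_real mulrA; congr (_ * _).
have E : (r * cos phi) ^+ 2 + (r * sin phi) ^+ 2 = r ^+ 2.
  by rewrite !exprMn -mulrDr cos2Dsin2 mulr1.
rewrite /cind indicE; case: ifPn => rj.
  by rewrite mem_set ?mul1r// /annulus /= E.
by rewrite memNset ?mul0r// /annulus /= E; exact/negP.
Qed.

Lemma mode_neq0 (R : realType) m j (z : plane R) : annulus R j z ->
  mode R m j z != 0.
Proof.
move=> zA; rewrite -sqnorm_eq0 sqnormM sqnorm_cind indicE mem_set// mul1r.
rewrite sqnorm_cpow sqnorm_zC expf_neq0// gt_eqF//.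
by move: zA => /andP[h _]; apply: lt_le_trans h; rewrite ltr0n.
Qed.

Lemma mode_nonnull (R : realType) m j : ~ eq_ae (mode R m j) (fun=> 0).
Proof.
move=> h; apply: (@annulus_nonnull R j).
apply: (ae_plane_mono _ h) => z /eqP mz; rewrite /cind indicE memNset//.
by move=> zA; move: mz; apply/negP; exact: mode_neq0.
Qed.

(** Rotations act on a mode by the scalar $e^{imt}$, so differentiability in norm reduces to that of
    a scalar exponential. *)
Lemma mode_Lz (R : realType) (hbar : R) (n a : nat) (l : int) j : (0 < n)%N ->
  Lz hbar n a (mode R (a%:Z + n%:Z * l) j)
    (fun z => (hbar * (a%:R + n%:R * l%:~R))%:C%C * mode R (a%:Z + n%:Z * l) j z).
Proof.
move=> n0; set m : int := a%:Z + n%:Z * l; have sm := mode_sector R a l j n0.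
have mE : m%:~R = a%:R + n%:R * l%:~R :> R by rewrite intrD intrM.
pose k : R[i] := Complex 0 m%:~R.
exists (fun z => k * mode R m j z); last first.
  apply/funext => z; rewrite [RHS]mulrA; congr (_ * _).
  by rewrite -mE; apply: complexP; rewrite !ReImE /=; ring.
apply/rotation_generatorP => //; split=> //; first exact: sectorZ.
move=> e e0; have sq := mode_sqi R m j.
have D0 : 0 < norm2 (mode R m j) + 1 by rewrite ltr_wpDl// norm2_ge0.
have [d d0 hd] := cexp_derive k (divr_gt0 e0 D0); exists d => // t t0 td.
have {}hd := hd t t0 td.
rewrite (_ : (fun z => _) =
    (fun z => ((t^-1)%:C%C * (cexp k t - 1) - k) * mode R m j z)); last first.
  apply/funext => z; rewrite mode_rot.
  have -> : expi (m%:~R * t) = cexp k t by rewrite /cexp /= mul0r expR0 mul1r.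
  ring.
rewrite norm2Z//; rewrite ltr_pdivlMr// in hd; apply: le_lt_trans hd.
by rewrite ler_wpM2l ?sqnorm_ge0// lerDl.
Qed.

Lemma mode_lin_indep (R : realType) m K :
  lin_indep (fun j : 'I_K => mode R m j).
Proof.
move=> c h j; apply/eqP; case: (eqVneq (c j) 0) => // cj.
exfalso; apply: (@annulus_nonnull R j); apply: (ae_plane_mono _ h) => z hz.
rewrite /cind indicE memNset// => zA.
move: hz; rewrite (bigD1 j)//= big1 ?addr0; last first.
  move=> i ij; rewrite /mode /cind indicE memNset ?mul0r ?mulr0//.
  move=> /andP[h1 h2]; move: zA => /andP[h3 h4].
  have := le_lt_trans h1 h4; have := le_lt_trans h3 h2; rewrite !ltr_nat !ltnS.
  move=> a1 a2; move: ij; apply/negP; rewrite negbK -val_eqE /= eqn_leq.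
  by rewrite a1 a2.
by move=> /eqP; rewrite mulf_eq0 (negbTE cj) (negbTE (mode_neq0 m zA)).
Qed.

Lemma Lz_level_point_spectrum (R : realType) (hbar : R) n a : (0 < n)%N ->
  Lz_level hbar n a `<=` point_spectrum (@Lz R hbar n a).
Proof.
move=> n0 lam [l ->]; exists (mode R (a%:Z + n%:Z * l) 0); split.
  exact: mode_nonnull.
exact: mode_Lz.
Qed.

(** * Polar coordinates and quantum numbers *)

Lemma polarE (R : realType) (z : plane R) : z != (0, 0) ->
  exists r phi : R, [/\ 0 < r, 0 <= phi < 2 * pi & z = (r * cos phi, r * sin phi)].
Proof.
case: z => x y z0; pose r := Num.sqrt (x ^+ 2 + y ^+ 2).
have p0 := pi_gt0 R.
have r20 : 0 < x ^+ 2 + y ^+ 2.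
  rewrite lt_neqAle addr_ge0 ?sqr_ge0// andbT eq_sym paddr_eq0 ?sqr_ge0// !sqrf_eq0.
  by move: z0; apply: contraNN => /andP[/eqP -> /eqP ->].
have r0 : 0 < r by rewrite sqrtr_gt0.
have r2 : r ^+ 2 = x ^+ 2 + y ^+ 2 by rewrite sqr_sqrtr// ltW.
have xr : -1 <= x / r <= 1.
  rewrite -ler_norml normrM normfV (gtr0_norm r0) ler_pdivrMr// mul1r.
  rewrite -(@ler_pXn2r _ 2)// ?nnegrE ?normr_ge0 ?(ltW r0)// real_normK ?num_real// r2.
  by rewrite lerDl sqr_ge0.
have rs : r * sin (acos (x / r)) = `|y|.
  rewrite sin_acos// -[X in X * _](gtr0_norm r0) -sqrtr_sqr -sqrtrM ?sqr_ge0//.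
  rewrite -sqrtr_sqr; congr Num.sqrt.
  by rewrite mulrBr mulr1 exprMn exprVn mulrCA mulfV ?mulr1 ?expf_neq0 ?gt_eqF//
    r2; ring.
have rc : r * cos (acos (x / r)) = x by rewrite acosK// mulrC divfK// gt_eqF.
have := acos_ge0 xr; have := acos_lepi xr => a1 a2.
case: (leP 0 y) => y0.
  exists r, (acos (x / r)); split => //; first by rewrite a2 /=; lra.
  by rewrite rs rc ger0_norm.
(* In the open lower half-plane the angle stays below $2\pi$, because a vanishing [acos] would force
   $y=0$. *)
exists r, (2 * pi - acos (x / r)); split => //.
  apply/andP; split; first by lra.
  rewrite gtrBl lt_neqAle a2 andbT eq_sym; apply/eqP => ac0.
  by move: rs; rewrite ac0 sin0 mulr0 => /esym/normr0_eq0 h; rewrite h ltxx in y0.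
have E : 2 * pi - acos (x / r) = - acos (x / r) + pi *+ 2 by rewrite mulr2n; ring.
by rewrite E cosD2pi sinD2pi cosN sinN mulrN rs rc ltr0_norm// opprK.
Qed.

Lemma mode_allowed (R : realType) (n a : nat) (l : int) : (0 < n)%N ->
  allowed n a (a%:R + n%:R * l%:~R : R).
Proof.
move=> n0; have := @mode_angular R (a%:Z + n%:Z * l) 0.
rewrite intrD intrM => ha; eexists; exists (mode R (a%:Z + n%:Z * l) 0); split.
- exact: ha.
- exact: mode_sector.
- exact: mode_nonnull.
Qed.

Lemma quantization (R : realType) (n a : nat) (m : R) : (0 < n)%N ->
  (exists l : int, m = a%:R + n%:R * l%:~R) <->
  expi (2 * pi * m / n%:R) = expi (2 * pi * a%:R / n%:R).
Proof.
move=> n0; have nn : n%:R != 0 :> R by rewrite pnatr_eq0 -lt0n.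
have p0 : pi != 0 :> R by rewrite gt_eqF// pi_gt0.
have solve (p : R) (k : R) : p != 0 ->
    (m = a%:R + n%:R * k) <-> 2 * p * m / n%:R - 2 * p * a%:R / n%:R = 2 * p * k.
  move=> p1; split=> [->|e]; first by field.
  have -> : m = a%:R + n%:R / (2 * p) * (2 * p * m / n%:R - 2 * p * a%:R / n%:R).
    by field; rewrite p1 nn.
  by rewrite e; field.
by split=> [[l /(solve _ _ p0) h]|/expi_inj[l /(solve _ _ p0) h]];
  [apply/expi_inj|]; exists l.
Qed.

Lemma expi_neq0 (R : realType) (t : R) : expi t != 0 :> R[i].
Proof. by rewrite -sqnorm_eq0 sqnorm_expi oner_neq0. Qed.

(** Since $2T\le2\pi$ for $T=2\pi/n$, from any angle in $[0,2\pi)$ a step by $T$ or by $-T$ stays in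
    that range. If the phases differed, the sector relation along this step would give $f(r)=0$, so
    $\psi$ would vanish almost everywhere. *)
Lemma allowed_boundary (R : realType) (n a : nat) (m : R) : (2 <= n)%N ->
  allowed n a m -> expi (2 * pi * m / n%:R) = expi (2 * pi * a%:R / n%:R).
Proof.
move=> n2 [f [psi [am [sq es] nz]]].
have n0 : 0 < n%:R :> R by rewrite ltr0n ltnW.
have p0 := pi_gt0 R; set T := 2 * pi / n%:R in es.
have T0 : 0 < T by rewrite divr_gt0// mulr_gt0.
have TT : T + T <= 2 * pi.
  have -> : T + T = 2 * pi * (2 / n%:R) by rewrite /T; field; rewrite gt_eqF.
  by rewrite ger_pMr ?mulr_gt0// ler_pdivrMr// mul1r ler_nat.
set w := expi (2 * pi * a%:R / n%:R) in es *.
case: (eqVneq (expi (2 * pi * m / n%:R)) w) => // mw; exfalso; apply: nz.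
have mT : expi (m * T) != w by rewrite /T mulrA (mulrC m) -mulrA in mw *.
have step (r phi : R) : 0 < r -> 0 <= phi -> phi + T < 2 * pi ->
    psi (rot T (r * cos phi, r * sin phi)) = w * psi (r * cos phi, r * sin phi) ->
    f r = 0.
  move=> r0 f0 fT.
  have -> : rot T (r * cos phi, r * sin phi) = (r * cos (phi + T), r * sin (phi + T)).
    by rewrite /rot cosD sinD /=; congr pair; ring.
  rewrite !am//; last 2 first.
  - by apply/andP; split; lra.
  - by apply/andP; split; lra.
  rewrite mulrDr expiD mulrCA mulrC [w * _]mulrCA => /eqP.
  rewrite -subr_eq0 (_ : _ - _ = f r * ((expi (m * T) - w) * expi (m * phi)));
    last by ring.
  by rewrite !mulf_eq0 subr_eq0 (negbTE mT) (negbTE (expi_neq0 _)) !orbF => /eqP.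
have null0 : {ae plane_measure R, forall z, z != (0, 0)}.
  exists (`[0, 0] `*` `[0, 0]); split; first exact: measurableX.
    by rewrite [LHS]rect_measure ?lexx// subrr mul0r.
  by move=> z /negP; rewrite negbK => /eqP -> /=; rewrite in_itv /= lexx.
apply: (ae_plane_mono2 _ null0
  (ae_plane_mono2 (fun z h1 h2 => conj h1 h2) es (ae_rot (- T) es))).
move=> z /polarE[r [phi [r0 /andP[f0 f2] ->]]] [h1 h2].
rewrite am ?f0//; suff -> : f r = 0 by rewrite mul0r.
case: (ltP (phi + T) (2 * pi)) => fT; first exact: step h1.
have E : rot (- T) (r * cos phi, r * sin phi) = (r * cos (phi - T), r * sin (phi - T)).
  by rewrite /rot cosD sinD cosN sinN /=; congr pair; ring.
rewrite E in h2; apply: step h2 => //; last by rewrite subrK.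
by lra.
Qed.

Lemma allowedE (R : realType) (n a : nat) : (2 <= n)%N ->
  allowed n a = [set m : R | exists l : int, m = a%:R + n%:R * l%:~R].
Proof.
move=> n2; have n0 : (0 < n)%N by rewrite ltnW.
apply/seteqP; split => m /=.
  by move=> /(allowed_boundary n2) /(quantization _ _ n0).
by move=> [l ->]; exact: mode_allowed.
Qed.

(** The integrand is constant on the sweep, so the total phase is $2\pi\,(p/(n\hbar)-a/n)$. *)
Lemma bohr_sommerfeldP (R : realType) (hbar : R) (n a : nat) (p : R) :
  0 < hbar -> (0 < n)%N ->
  bohr_sommerfeld hbar n a p <-> p / (n%:R * hbar) - a%:R / n%:R \is a Num.int.
Proof.
move=> h0 n0; have nn : 0 < n%:R :> R by rewrite ltr0n.
have p0 := pi_gt0 R; have T0 : 0 < 2 * pi / n%:R :> R by rewrite divr_gt0// mulr_gt0.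
rewrite /bohr_sommerfeld /= /orbifold_holonomy.
rewrite (Rintegral_cst_fin _ (measurable_itv0 _) (measure_itv0 T0)) -expiD.
have E (q : R) : hbar^-1 * (p * (2 * q / n%:R)) - 2 * q * a%:R / n%:R =
    2 * q * (p / (n%:R * hbar) - a%:R / n%:R).
  by field; rewrite !gt_eqF.
rewrite E; split=> [/expi_eq1[k /mulfI h]|/intrP[k ->]].
  by rewrite h ?intr_int// gt_eqF// mulr_gt0.
by apply/expi_eq1; exists k.
Qed.

Lemma bohr_sommerfeld_boundary (R : realType) (hbar : R) (n a : nat) (m : R) :
  0 < hbar -> (0 < n)%N ->
  bohr_sommerfeld hbar n a (hbar * m) <->
  expi (2 * pi * m / n%:R) = expi (2 * pi * a%:R / n%:R).
Proof.
move=> h0 n0; have nn : 0 < n%:R :> R by rewrite ltr0n.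
have T0 : 0 < 2 * pi / n%:R :> R by rewrite divr_gt0// mulr_gt0// pi_gt0.
rewrite /bohr_sommerfeld /= /orbifold_holonomy.
rewrite (Rintegral_cst_fin _ (measurable_itv0 _) (measure_itv0 T0)) -expiD.
rewrite -!mulrA mulKf ?gt_eqF// [m * _]mulrC -!mulrA.
by split=> [/expi_eq1/expi_inj|/expi_inj/expi_eq1]; rewrite -?mulrA ?[m / _]mulrC.
Qed.

Theorem theorem6p2 (R : realType) (hbar : R) (hbar_gt0 : 0 < hbar)
    (n : nat) (n_ge2 : (2 <= n)%N) (a : 'I_n) :
  [/\ (* allowed angular-momentum quantum numbers *)
      allowed n a = [set m : R | exists l : int, m = a%:R + n%:R * l%:~R],
      (* self-adjointness and spectrum of L_z on the sector *)
      self_adjoint n a (Lz hbar n a) /\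
      spectrum n a (Lz hbar n a) =
        [set lam : R[i] |
          exists l : int, lam = (hbar * (a%:R + n%:R * l%:~R))%:C%C],
      (* eigenvalues and their multiplicity *)
      point_spectrum (Lz hbar n a) = spectrum n a (Lz hbar n a) /\
      (forall lam : R[i], point_spectrum (Lz hbar n a) lam ->
         exists m : R, [/\ allowed n a m, lam = (hbar * m)%:C%C &
           infinite_radial_multiplicity (Lz hbar n a) lam m]),
      (* boundary-condition requirement *)
      allowed n a =
        [set m : R | expi (2 * pi * m / n%:R) = expi (2 * pi * a%:R / n%:R)] &
      (* orbifold Bohr--Sommerfeld condition *)
      allowed n a = [set m : R | bohr_sommerfeld hbar n a (hbar * m)] /\
      (forall pphi : R, bohr_sommerfeld hbar n a pphi <->
         pphi / (n%:R * hbar) - a%:R / n%:R \is a Num.int)].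
Proof.
have n0 : (0 < n)%N by rewrite ltnW.
have sub1 := @point_spectrum_sub R hbar n a.
have sub2 := @Lz_spectrum_sub R hbar n a hbar_gt0 n0.
have sub3 := @Lz_level_point_spectrum R hbar n a n0.
(* The inclusions form a cycle through the point spectrum, the spectrum and the lattice, so all
   three sets coincide. *)
have spE : spectrum n a (Lz hbar n a) = Lz_level hbar n a.
  by apply/seteqP; split => //; exact: subset_trans sub1.
have ptE : point_spectrum (Lz hbar n a) = spectrum n a (Lz hbar n a).
  by apply/seteqP; split => //; exact: subset_trans sub3.
have bcE : allowed n a =
    [set m : R | expi (2 * pi * m / n%:R) = expi (2 * pi * a%:R / n%:R)].
  rewrite allowedE//; apply/seteqP; split => m /=; by move/(quantization _ _ n0).
split=> //.
- exact: allowedE.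
- by split; [exact: Lz_self_adjoint|exact: spE].
- split=> // lam; rewrite ptE spE => -[l ->].
  exists (a%:R + n%:R * l%:~R); split => //; first exact: mode_allowed.
  move=> K; have ha := @mode_angular R (a%:Z + n%:Z * l).
  rewrite intrD intrM in ha.
  eexists; exists (fun j : 'I_K => mode R (a%:Z + n%:Z * l) j); split.
  + by move=> j; exact: ha.
  + by move=> j; exact: mode_Lz.
  + exact: mode_lin_indep.
- split; last by move=> p; exact: bohr_sommerfeldP.
  rewrite bcE; apply/seteqP; split => m /=;
    by move/(bohr_sommerfeld_boundary _ _ hbar_gt0 n0).
Qed.
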